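(* Let $M,N$ be positive integers with $60\log N\leq M\leq\frac{N-1}{4\log N}$. Let $G$ be a random real $M\times N$ matrix whose entries are drawn independently from the Gaussian distribution of zero mean and unit variance, with columns $g_1,\ldots,g_N$. Let $F$ be the $M\times N$ matrix with columns $f_n:=\frac{g_n}{\|g_n\|}$ for $n=1,\ldots,N$ (a normalized Gaussian frame). Then the following inequalities simultaneously hold with probability exceeding $1-11N^{-1}$: (i) $\mu_F\leq\frac{\sqrt{15\log N}}{\sqrt{M}-\sqrt{12\log N}}$, (ii) $\nu_F\leq\frac{\sqrt{15\log N}}{M-\sqrt{12M\log N}}$, (iii) $\|F\|_2\leq\frac{\sqrt{M}+\sqrt{N}+\sqrt{2\log N}}{\sqrt{M-\sqrt{8M\log N}}}$.
   Context: $\log$ is the natural logarithm, $\|\cdot\|$ on vectors is the Euclidean norm, and $\|F\|_2$ is the spectral norm (largest singular value) of $F$. For an $M\times N$ matrix $F$ with unit-norm columns $f_1,\ldots,f_N$, the worst-case coherence is $\mu_F:=\max_{i\neq j}|\langle f_i,f_j\rangle|$ and the average coherence is $\nu_F:=\frac{1}{N-1}\max_{i\in\{1,\ldots,N\}}\big|\sum_{j\neq i}\langle f_i,f_j\rangle\big|$, where $i,j$ range over $\{1,\ldots,N\}$. *)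

(* Defs.v *)
From HB Require Import structures.
From mathcomp Require Import all_boot all_order all_algebra.
From mathcomp Require Import all_classical all_reals all_analysis.
Set Implicit Arguments.
Unset Strict Implicit.
Unset Printing Implicit Defensive.
Import Order.TTheory GRing.Theory Num.Theory.
Local Open Scope classical_set_scope.
Local Open Scope ring_scope.

Definition inner (R : realType) (M : nat) (u v : 'cV[R]_M) : R :=
  \sum_(i < M) u i 0 * v i 0.

Definition enorm (R : realType) (M : nat) (u : 'cV[R]_M) : R :=
  Num.sqrt (inner u u).

(* A zero column is left equal to zero, since x / 0 = 0. *)
Definition normalize_columns (R : realType) (M N : nat) (G : 'M[R]_(M, N)) :
    'M[R]_(M, N) :=
  \matrix_(m, n) (G m n / enorm (col n G)).

(* The maxima below are taken over nonnegative reals, so starting them at 0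
   does not change them whenever the index set is nonempty (N >= 2). *)
Definition worst_case_coherence (R : realType) (M N : nat)
    (F : 'M[R]_(M, N)) : R :=
  \big[Num.max/0]_(p : 'I_N * 'I_N | p.1 != p.2)
    `|inner (col p.1 F) (col p.2 F)|.

Definition average_coherence (R : realType) (M N : nat)
    (F : 'M[R]_(M, N)) : R :=
  (N%:R - 1)^-1 *
  \big[Num.max/0]_(i < N) `|\sum_(j < N | j != i) inner (col i F) (col j F)|.

(* Square roots of the eigenvalues of F^T F (all of which are >= 0).  When
   M < N this contains 0 in addition to the min(M, N) singular values, which
   does not affect the largest one. *)
Definition singular_values (R : realType) (M N : nat)
    (F : 'M[R]_(M, N)) : set R :=
  [set Num.sqrt a | a in [set a | eigenvalue (F^T *m F) a]].

(* For N > 0 the set of singular values is finite and nonempty, so its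
   supremum is its largest element. *)
Definition spectral_norm (R : realType) (M N : nat) (F : 'M[R]_(M, N)) : R :=
  sup (singular_values F).

Definition mutually_independent (d : measure_display) (T : measurableType d)
    (R : realType) (P : probability T R) (I : finType)
    (X : I -> {RV P >-> R}) : Prop :=
  forall (J : {set I}) (A : I -> set R),
    (forall i, measurable (A i)) ->
    P (\bigcap_(i in [set` J]) (X i @^-1` A i)) =
    (\prod_(i in J) P (X i @^-1` A i))%E.

Definition standard_gaussian (d : measure_display) (T : measurableType d)
    (R : realType) (P : probability T R) (X : {RV P >-> R}) : Prop :=
  forall A : set R, measurable A -> distribution P X A = normal_prob 0 1 A.

Definition iid_gaussian_matrix (d : measure_display) (T : measurableType d)
    (R : realType) (P : probability T R) (M N : nat)
    (G : 'I_M -> 'I_N -> {RV P >-> R}) : Prop :=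
  mutually_independent (fun p : 'I_M * 'I_N => G p.1 p.2) /\
  forall m n, standard_gaussian (G m n).

Definition normalized_gaussian_frame (d : measure_display)
    (T : measurableType d) (R : realType) (P : probability T R) (M N : nat)
    (G : 'I_M -> 'I_N -> {RV P >-> R}) (w : T) : 'M[R]_(M, N) :=
  normalize_columns (\matrix_(m, n) G m n w).

(* Main.v *)
(* The entries of G may be taken to be the coordinates of a standard Gaussian
   vector.  With L = log N, all the squared column norms exceed
   c^2 = M - sqrt (8 M L) outside an event of probability at most 1 / N, by the
   Laplace transform of the chi-square law.

   Coherence: <f_i, f_j> is <f_i, g_j> / |g_j|, which agrees with
   <f_i, g_j> / max(|g_j|, c) on that event.  Flipping the sign of g_j shows that
   the exponential moments of a sum over j of the latter variables are at most
   those of the sum of the <f_i, g_j> / c, which is Gaussian given g_i.  Chernoff's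
   bound and a union bound then control both coherences.

   Spectral norm: the processes <w, G u> + xi and <g, u> + <h, w>, for u and w in
   finite nets of the unit spheres, have the same variances, so Slepian's
   inequality (proved by interpolation for the exponential of a multiple of the
   soft maximum) bounds exponential moments of max <w, G u> by those of
   |g| + |h|.  This gives |G| <= sqrt M + sqrt N + sqrt (2 L) outside an event of
   probability at most e / N. *)
Require Import Defs.
From HB Require Import structures.
From mathcomp Require Import all_boot all_order all_algebra.
From mathcomp Require Import all_classical all_reals all_analysis.
From mathcomp Require Import finmap measurable_realfun ring lra.
Set Implicit Arguments.
Unset Strict Implicit.
Unset Printing Implicit Defensive.
Import Order.TTheory GRing.Theory Num.Theory.
Import numFieldNormedType.Exports.
Local Open Scope classical_set_scope.
Local Open Scope ring_scope.

(** * The standard Gaussian law on the line *)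

(** Comparing exponential moments, instead of expectations, yields the size of |G| and its tail in
    one step, with no separate concentration theorem. The function compared is exp (al * lse y) with
    0 <= al <= 1: its mixed second derivatives carry the factor al * (al - 1) <= 0, the sign that
    the interpolation needs. The nets come from compactness, with no bound on their size. Since al *
    be = l is all that matters in the limit, al is taken so small that the entropy term al * ln #|L
    * K| is at most 1/2, and the mesh so fine that passing from the nets to the spheres costs at
    most another 1/2: these two halves are the factor e. Dividing by E exp (l xi) = exp (l^2 / 2)
    turns the l^2 obtained from |g| + |h| into l^2 / 2, so l = sqrt (2 L) gives a tail of order 1 /
    N. For the coherences, <f_i, g_j> is Gaussian given g_i but <f_i, f_j> is not. Truncating |g_j|
    from below at c, instead of conditioning on the event that it is large, keeps the law of G
    intact and hence its sign symmetry. *)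

Section normal_integral.
Variable R : realType.
Local Notation mu := (@lebesgue_measure R).

Import HBNNSimple.

Lemma measurable_EFin_normal_pdf (m s : R) :
  measurable_fun [set: R] (fun x : R => (normal_pdf m s x)%:E).
Proof. by apply/measurable_EFinP; exact: measurable_normal_pdf. Qed.

(** The usual ascent: indicators, then simple functions, then monotone limits. *)
Lemma ge0_integral_normal_prob (m s : R) (f : R -> \bar R) :
  measurable_fun setT f -> (forall x, 0 <= f x)%E ->
  (\int[normal_prob m s]_x f x = \int[mu]_x (f x * (normal_pdf m s x)%:E))%E.
Proof.
move=> mf f0; pose p x : \bar R := (normal_pdf m s x)%:E.
have mp : measurable_fun setT p.
  exact: measurable_EFin_normal_pdf.
have p0 x : (0 <= p x)%E by rewrite lee_fin normal_pdf_ge0.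
have indicP (A : set (measurableTypeR R)) : measurable A ->
    (\int[normal_prob m s]_x (\1_A x)%:E = \int[mu]_x ((\1_A x)%:E * p x))%E.
  move=> mA; rewrite integral_indic//= setIT /normal_prob integral_mkcond.
  apply: eq_integral => x _; rewrite patchE indicE.
  by case: ifPn => xA; rewrite ?mul1e ?mul0e.
have nnsfunP (h : {nnsfun measurableTypeR R >-> R}) :
    (\int[normal_prob m s]_x (h x)%:E = \int[mu]_x ((h x)%:E * p x))%E.
  under [LHS]eq_integral do rewrite fimfunE -fsumEFin//.
  rewrite [LHS]ge0_integral_fsum//; last 2 first.
    - by move=> r; apply/measurable_EFinP/measurable_funM => //; exact: measurable_indic.
    - by move=> n x _; rewrite EFinM nnfun_muleindic_ge0.
  under [RHS]eq_integral.
    move=> x xD; rewrite fimfunE -fsumEFin// muleC ge0_mule_fsumr; last first.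
      by move=> r; rewrite EFinM nnfun_muleindic_ge0.
    over.
  rewrite [RHS]ge0_integral_fsum//; last 2 first.
    - move=> r; apply: emeasurable_funM => //.
      by apply/measurable_EFinP/measurable_funM => //; exact: measurable_indic.
    - by move=> n x _; rewrite mule_ge0// EFinM nnfun_muleindic_ge0.
  apply: eq_fsbigr => r _.
  rewrite !integralZl_indic_nnsfun//= indicP//.
  have [r0|r0] := leP 0 r.
    rewrite -ge0_integralZl//=.
    - by apply: eq_integral => x _; rewrite [RHS]muleC EFinM muleA.
    - by apply: emeasurable_funM => //; exact/measurable_EFinP/measurable_indic.
    - by move=> x _; rewrite mule_ge0// lee_fin.
  rewrite (_ : h @^-1` [set r] = set0); last by apply: preimage_nnfun0.
  rewrite [X in (_ * X)%E]integral0_eq ?mule0; last first.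
    by move=> x _; rewrite indic0 mul0e.
  by rewrite integral0_eq// => x _; rewrite indic0 mulr0 mule0.
have mf' : measurable_fun [set: measurableTypeR R] f := mf.
pose f_ := nnsfun_approx measurableT mf'.
transitivity (lim (\int[normal_prob m s]_x (f_ n x)%:E @[n --> \oo])%E).
  rewrite -monotone_convergence//=.
  - by apply: eq_integral => x _; apply/esym/cvg_lim => //=; exact: cvg_nnsfun_approx.
  - by move=> n; exact/measurable_EFinP/measurable_funTS.
  - by move=> n ? _; rewrite lee_fin.
  - by move=> ? _ ? ? mn; rewrite lee_fin; exact/lefP/nd_nnsfun_approx.
transitivity (lim (\int[mu]_x ((f_ n x)%:E * p x) @[n --> \oo])%E).
  by apply/congr_lim/funext => n; exact: nnsfunP.
rewrite -monotone_convergence//=.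
- apply: eq_integral => x _; apply/cvg_lim => //=.
  apply: cvgeZr => //; exact: cvg_nnsfun_approx.
- by move=> n; apply: emeasurable_funM => //; exact/measurable_EFinP.
- by move=> n ? _; rewrite mule_ge0// lee_fin.
- move=> ? _ ? ? mn; apply: lee_wpmul2r => //.
  by rewrite lee_fin; exact/lefP/nd_nnsfun_approx.
Qed.

Lemma lebesgue_measure_shift (s : R) (A : set R) : measurable A ->
  pushforward mu ((fun z : R => z + s) : _ -> measurableTypeR R) A = mu A.
Proof.
move=> mA.
have ms : measurable_fun setT ((fun z : R => z + s) : measurableTypeR R -> measurableTypeR R).
  exact: measurable_funD.
apply/esym/lebesgue_measure_unique => //= _ [[a b]] _ <-.
rewrite /pushforward.
have -> : (fun z : R => z + s) @^-1` `](a, b).1, (a, b).2]%classic = `]a - s, b - s]%classic.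
  by apply/seteqP; split => z /=; rewrite !in_itv/= ltrBlDr lerBrDr.
rewrite !lebesgue_measure_itv/= !lte_fin ltrD2r; case: ifP => // _.
by rewrite -!EFinB; congr EFin; lra.
Qed.

Lemma ge0_integral_shift (s : R) (f : R -> \bar R) :
  measurable_fun setT f -> (forall x, 0 <= f x)%E ->
  (\int[mu]_x f (x + s)%R = \int[mu]_x f x)%E.
Proof.
move=> mf f0.
have ms : measurable_fun setT ((fun z : R => z + s) : measurableTypeR R -> measurableTypeR R).
  exact: measurable_funD.
have := @ge0_integral_pushforward _ _ _ _ _ _ ms mu setT f measurableT mf.
rewrite preimage_setT /comp => <-; last by move=> x _; exact: f0.
by apply: eq_measure_integral => A mA _; apply: lebesgue_measure_shift.
Qed.

Lemma normal_pdf01 (x : R) :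
  normal_pdf 0 1 x = (Num.sqrt (pi *+ 2))^-1 * expR (- x ^+ 2 / 2).
Proof.
by rewrite normal_pdfE// /normal_peak /normal_fun expr1n mul1r subr0.
Qed.

(* The standard Gaussian law as a measure on [R] itself: [normal_prob] lives on
   the alias [measurableTypeR R], whose measurable structure has another
   display. *)
Definition gauss : set R -> \bar R := normal_prob 0 1.

Let gauss0 : gauss set0 = 0%E.
Proof. exact: measure0. Qed.

Let gauss_ge0 A : (0 <= gauss A)%E.
Proof. exact: measure_ge0. Qed.

Let gauss_semi_sigma_additive : semi_sigma_additive gauss.
Proof. exact: (@measure_semi_sigma_additive _ _ _ (normal_prob 0 1)). Qed.

HB.instance Definition _ := isMeasure.Build _ R R gauss
  gauss0 gauss_ge0 gauss_semi_sigma_additive.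

Let gauss_setT : gauss setT = 1%E.
Proof. exact: (@probability_setT _ _ _ (normal_prob 0 1)). Qed.

HB.instance Definition _ :=
  @Measure_isProbability.Build _ R R gauss gauss_setT.

Lemma ge0_integral_gauss (f : R -> \bar R) :
  measurable_fun setT f -> (forall x, 0 <= f x)%E ->
  (\int[gauss]_x f x = \int[mu]_x (f x * (normal_pdf 0 1 x)%:E))%E.
Proof.
move=> mf f0; rewrite -ge0_integral_normal_prob//.
have mid : measurable_fun setT (idfun : measurableTypeR R -> R).
  by move=> _ A mA; rewrite setTI.
have := @ge0_integral_pushforward _ _ _ _ _ _ mid (normal_prob 0 1) setT f measurableT mf.
rewrite preimage_setT /comp => <-; last by move=> x _; exact: f0.
exact: eq_measure_integral.
Qed.

(** The one-dimensional Cameron-Martin formula: a translation moves the shift onto the density, and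
    the ratio of the densities at [z - s] and [z] is exp (s z - s^2 / 2). Laplace transforms and
    integration by parts both come from it. *)
Lemma gauss_shift (s : R) (f : R -> \bar R) :
  measurable_fun setT f -> (forall x, 0 <= f x)%E ->
  (\int[gauss]_z f (z + s)%R =
   \int[gauss]_z (f z * (expR (s * z - s ^+ 2 / 2))%:E))%E.
Proof.
move=> mf f0.
have ms : measurable_fun setT (fun z : R => z + s) by exact: measurable_funD.
have me : measurable_fun setT (fun z : R => expR (s * z - s ^+ 2 / 2)).
  by apply: measurableT_comp => //; exact: measurable_funB.
have mfe : measurable_fun setT (fun z : R => f z * (expR (s * z - s ^+ 2 / 2))%:E)%E.
  by apply: emeasurable_funM => //; exact/measurable_EFinP.
have mp := measurable_EFin_normal_pdf 0 1.
rewrite ge0_integral_gauss//; last exact: (measurableT_comp mf).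
rewrite ge0_integral_gauss//; last first.
  by move=> z; rewrite mule_ge0// lee_fin expR_ge0.
rewrite -[RHS](ge0_integral_shift s); last 2 first.
- exact: (emeasurable_funM mfe mp).
- by move=> z; rewrite !mule_ge0// lee_fin ?expR_ge0 ?normal_pdf_ge0.
apply: eq_integral => z _; rewrite -muleA -EFinM; congr (_ * _%:E)%E.
rewrite !normal_pdf01 mulrCA -expRD; congr (_ * expR _).
by field.
Qed.

Lemma normal_pdf01N (x : R) : normal_pdf 0 1 (- x) = normal_pdf 0 1 x.
Proof. by rewrite !normal_pdf01 sqrrN. Qed.

Lemma ge0_integral_opp (f : R -> \bar R) :
  measurable_fun setT f -> (forall x, 0 <= f x)%E ->
  (\int[mu]_x f (- x)%R = \int[mu]_x f x)%E.
Proof.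
move=> mf f0.
have mN : measurable_fun setT (-%R : measurableTypeR R -> measurableTypeR R).
  exact: measurable_funN.
have := @ge0_integral_pushforward _ _ _ _ _ _ mN mu setT f measurableT mf.
rewrite preimage_setT /comp => <-; last by move=> x _; exact: f0.
by apply: eq_measure_integral => A mA _; apply: lebesgue_measureN.
Qed.

Lemma gaussN (A : set R) : measurable A ->
  gauss (-%R @^-1` A) = gauss A.
Proof.
move=> mA; rewrite /gauss /normal_prob integral_mkcond [RHS]integral_mkcond.
rewrite -[RHS]ge0_integral_opp; first last.
- by move=> x; rewrite patchE; case: ifP => // _; rewrite lee_fin normal_pdf_ge0.
- exact: (iffLR (measurable_restrictT _ mA) (measurable_funTS (@measurable_EFin_normal_pdf 0 1))).
by apply: eq_integral => x _; rewrite !patchE normal_pdf01N.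
Qed.

(* [exp (x z^2 / 2)] times the standard Gaussian density is, up to a constant,
   the Gaussian density of variance [1 / (1 - x)]. *)
Lemma gauss_expR_sqr (x : R) : x < 1 ->
  (\int[gauss]_z (expR (x * z ^+ 2 / 2))%:E =
   ((Num.sqrt (1 - x))^-1)%:E)%E.
Proof.
move=> x1; have x0 : 0 < 1 - x by rewrite subr_gt0.
have q0 : 0 < Num.sqrt (1 - x) by rewrite sqrtr_gt0.
rewrite ge0_integral_gauss; last 2 first.
- apply/measurable_EFinP; apply: measurableT_comp => //.
  by apply: measurable_funM => //; exact: measurable_funM.
- by move=> z; rewrite lee_fin expR_ge0.
transitivity (\int[mu]_z ((((Num.sqrt (1 - x))^-1)%:E *
    (normal_pdf 0 (Num.sqrt (1 - x))^-1 z)%:E)))%E.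
  apply: eq_integral => z _; rewrite -!EFinM; congr EFin.
  rewrite normal_pdf01 normal_pdfE ?invr_neq0 ?gt_eqF//.
  rewrite /normal_peak /normal_fun subr0.
  rewrite mulrCA -expRD [RHS]mulrA; congr (_ * expR _).
    rewrite exprVn sqr_sqrtr ?ltW// -mulrnAr sqrtrM ?invr_ge0 ?ltW//.
    by rewrite sqrtrV ?ltW// invfM invrK mulrA mulVf ?gt_eqF// mul1r.
  rewrite exprVn sqr_sqrtr ?ltW//; field; rewrite gt_eqF//.
rewrite ge0_integralZl//; first by rewrite integral_normal_pdf mule1.
- exact: measurable_EFin_normal_pdf.
- by move=> z _; rewrite lee_fin normal_pdf_ge0.
Qed.

End normal_integral.

(** * Gaussian vectors *)

Section gaussian_product.
Variable R : realType.
Local Notation gauss := (@gauss R).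

Definition tcons n (p : R * n.-tuple R) : n.+1.-tuple R := [tuple of p.1 :: p.2].

Lemma measurable_tcons n : measurable_fun setT (@tcons n).
Proof. exact: (measurable_cons measurable_fst measurable_snd). Qed.

HB.instance Definition _ n := isMeasurableFun.Build _ _ _ _ (@tcons n) (@measurable_tcons n).

(** The n-fold product of [gauss], built one coordinate at a time so that its properties follow by
    induction and Tonelli. *)
Fixpoint gaussn n : probability (n.-tuple R) R :=
  match n return probability (n.-tuple R) R with
  | 0 => \d_ [tuple]
  | n'.+1 => distribution (gauss \x gaussn n')%E (@tcons n')
  end.

Lemma ge0_integral_gaussn0 (f : 0.-tuple R -> \bar R) :
  measurable_fun setT f ->
  (\int[gaussn 0]_v f v = f [tuple])%E.
Proof. by move=> mf; rewrite integral_dirac// diracT mul1e. Qed.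

Lemma ge0_integral_gaussnS n (f : n.+1.-tuple R -> \bar R) :
  measurable_fun setT f -> (forall v, 0 <= f v)%E ->
  (\int[gaussn n.+1]_v f v =
   \int[(gauss \x gaussn n)%E]_p f (tcons p))%E.
Proof. by move=> mf f0; rewrite /= ge0_integral_distribution. Qed.

Definition box n (A : 'I_n -> set R) : set (n.-tuple R) :=
  [set v | forall i, A i (tnth v i)].

Lemma measurable_box n (A : 'I_n -> set R) :
  (forall i, measurable (A i)) -> measurable (box A).
Proof.
move=> mA; rewrite (_ : box A = \bigcap_(i in [set: 'I_n]) ((@tnth n R)^~ i @^-1` A i)).
  apply: fin_bigcap_measurable => // i _.
  by rewrite -[X in measurable X]setTI; exact: measurable_tnth.
by apply/seteqP; split => [v Av i _|v Av i]; exact: Av.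
Qed.

Lemma measurable_tupleE n :
  (@measurable _ (n.-tuple R)) =
  <<s [set B | exists2 A : 'I_n -> set R, (forall i, measurable (A i)) & B = box A] >>.
Proof.
set G := [set B | _]; apply/seteqP; split; last first.
  apply: smallest_sub; first exact: sigma_algebra_measurable.
  by move=> B [A mA ->]; exact: measurable_box.
have mid : measurable_fun setT (idfun : g_sigma_algebraType G -> n.-tuple R).
  apply/measurable_fun_tnthP => i _ B mB; rewrite setTI; apply: sub_sigma_algebra.
  exists (fun j => if j == i then B else setT).
    by move=> j; case: ifP.
  apply/seteqP; split => [v Bv j|v /(_ i)]; last by rewrite eqxx.
  by case: eqP => // ->.
by move=> B mB; have := mid measurableT B mB; rewrite setTI.
Qed.

Lemma gaussn_box n (A : 'I_n -> set R) : (forall i, measurable (A i)) ->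
  gaussn n (box A) = (\prod_(i < n) gauss (A i))%E.
Proof.
elim: n A => [|n IHn] A mA.
  rewrite big_ord0 /= diracE mem_set// => -[].
  by case.
rewrite big_ord_recl /= /distribution /pushforward.
rewrite (_ : _ @^-1` _ = A ord0 `*` box (fun i => A (lift ord0 i))); last first.
  apply/seteqP; split => [[z v] Av|[z v] [Az Av] i].
    split => /=; first by have := Av ord0; rewrite tnth0.
    by move=> i; have := Av (lift ord0 i); rewrite tnthS.
  case: (unliftP ord0 i) => [j ->|->]; last by rewrite tnth0.
  by rewrite tnthS; exact: Av.
rewrite product_measure1E//; last exact: measurable_box.
by congr (_ * _)%E; exact: IHn.
Qed.

(** Boxes are stable under intersection and generate the measurable sets of tuples. *)
Lemma gaussn_unique n (m : {measure set (n.-tuple R) -> \bar R}) :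
  (forall A : 'I_n -> set R, (forall i, measurable (A i)) ->
     m (box A) = (\prod_(i < n) gauss (A i))%E) ->
  forall B, measurable B -> gaussn n B = m B.
Proof.
move=> mE B mB.
have boxT : setT = box (fun _ : 'I_n => [set: R]) by apply/seteqP; split.
apply: (measure_unique _ (fun _ => setT) (measurable_tupleE n)) => //.
- move=> _ _ [A1 mA1 ->] [A2 mA2 ->]; exists (fun i => A1 i `&` A2 i).
    by move=> i; exact: measurableI.
  by apply/seteqP; split => [v [v1 v2] i|v v12]; [split|split => i; have [] := v12 i].
- by move=> i; exists (fun=> setT).
- by apply/seteqP; split => // v _; exists 0%N.
- by move=> _ [A mA ->]; apply: (etrans (gaussn_box mA)); rewrite mE.
- by move=> k; rewrite -ge0_fin_numE// fin_num_measure.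
Qed.

(** The transfer principle behind every change of variables below (sign flips, resampling,
    marginals, the given matrix [G]): it suffices to compute the law of [X] on boxes. *)
Lemma ge0_integral_gaussn_law n d (T : measurableType d) (P : probability T R)
    (X : T -> n.-tuple R) (f : n.-tuple R -> \bar R) :
  measurable_fun setT X ->
  (forall A : 'I_n -> set R, (forall i, measurable (A i)) ->
     P (X @^-1` box A) = (\prod_(i < n) gauss (A i))%E) ->
  measurable_fun setT f -> (forall v, 0 <= f v)%E ->
  (\int[gaussn n]_v f v = \int[P]_t f (X t))%E.
Proof.
move=> mX PX mf f0.
have := @ge0_integral_pushforward _ _ _ _ _ _ mX P setT f measurableT mf.
rewrite preimage_setT /comp => <-; last by move=> x _; exact: f0.
apply: eq_measure_integral => B mB _; exact: (@gaussn_unique n (pushforward P X)).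
Qed.

Lemma measurable_prod_tnth n (f : 'I_n -> R -> R) :
  (forall i, measurable_fun setT (f i)) ->
  measurable_fun setT (fun v : n.-tuple R => \prod_(i < n) f i (tnth v i)).
Proof.
move=> mf; apply: measurable_prod => i _.
exact: (measurableT_comp (mf i) (@measurable_tnth _ _ n i)).
Qed.

Lemma ge0_integral_gaussn_prod n (f : 'I_n -> R -> R) :
  (forall i, measurable_fun setT (f i)) -> (forall i z, 0 <= f i z) ->
  (\int[gaussn n]_v (\prod_(i < n) f i (tnth v i))%:E =
   \prod_(i < n) \int[gauss]_z (f i z)%:E)%E.
Proof.
elim: n f => [|n IHn] f mf f0.
  rewrite ge0_integral_gaussn0 ?big_ord0//.
  by apply/measurable_EFinP; exact: measurable_prod_tnth.
have mp := @measurable_prod_tnth n (fun i => f (lift ord0 i)) (fun i => mf _).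
rewrite ge0_integral_gaussnS; last 2 first.
- by apply/measurable_EFinP; exact: measurable_prod_tnth.
- by move=> v; rewrite lee_fin prodr_ge0.
rewrite big_ord_recl /= -IHn//.
rewrite (_ : (fun p => _) = (fun p : R * n.-tuple R =>
   (f ord0 p.1)%:E * (\prod_(i < n) f (lift ord0 i) (tnth p.2 i))%:E)%E); last first.
  apply/funext => -[z v] /=; rewrite big_ord_recl tnth0 EFinM; congr (_ * _%:E)%E.
  by apply: eq_bigr => i _; rewrite tnthS.
rewrite fubini_tonelli1/=; last 2 first.
- apply: emeasurable_funM; apply/measurable_EFinP.
    exact: (measurableT_comp (mf ord0)).
  exact: (measurableT_comp mp).
- by move=> p; rewrite mule_ge0// lee_fin ?prodr_ge0.
rewrite /fubini_F/=.
under eq_integral => z _.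
  rewrite ge0_integralZl//; last 3 first.
  - exact/measurable_EFinP.
  - by move=> v _; rewrite lee_fin prodr_ge0.
  - by rewrite lee_fin.
  over.
rewrite ge0_integralZr//.
- exact/measurable_EFinP.
- by move=> z _; rewrite lee_fin.
- by apply: integral_ge0 => v _; rewrite lee_fin prodr_ge0.
Qed.

Definition tadd n (c : 'I_n -> R) (v : n.-tuple R) : n.-tuple R :=
  [tuple tnth v i + c i | i < n].

Lemma measurable_tadd n c : measurable_fun setT (@tadd n c).
Proof.
apply/measurable_fun_tnthP => i.
rewrite (_ : _ \o _ = (fun v => tnth v i + c i)); last first.
  by apply/funext => v /=; rewrite tnth_mktuple.
by apply: measurable_funD => //; exact: measurable_tnth.
Qed.

(** Density, with respect to [gaussn n], of its translate by [c]. *)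
Definition cameron_martin n (c : 'I_n -> R) (v : n.-tuple R) : R :=
  expR (\sum_(i < n) (c i * tnth v i - c i ^+ 2 / 2)).

Lemma measurable_cameron_martin n c : measurable_fun setT (@cameron_martin n c).
Proof.
apply: measurableT_comp => //; apply: measurable_sum => i.
by apply: measurable_funB => //; apply: measurable_funM => //; exact: measurable_tnth.
Qed.

Lemma gaussn_shift n (c : 'I_n -> R) (f : n.-tuple R -> \bar R) :
  measurable_fun setT f -> (forall v, 0 <= f v)%E ->
  (\int[gaussn n]_v f (tadd c v) = \int[gaussn n]_v (f v * (cameron_martin c v)%:E))%E.
Proof.
elim: n c f => [|n IHn] c f mf f0.
  rewrite !ge0_integral_gaussn0.
  - rewrite /cameron_martin big_ord0 expR0 mule1; congr f.
    by rewrite [tadd _ _]tuple0.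
  - by apply: emeasurable_funM => //; apply/measurable_EFinP; exact: measurable_cameron_martin.
  - exact: (measurableT_comp mf (measurable_tadd c)).
have mcm (k : nat) (a : 'I_k -> R) := iffRL (measurable_EFinP _ _) (measurable_cameron_martin a).
pose c' i := c (lift ord0 i).
have mft : measurable_fun setT (fun p : R * n.-tuple R => f (tcons p)).
  exact: (measurableT_comp mf (@measurable_tcons n)).
have taddE z v : tadd c (tcons (z, v)) = tcons (z + c ord0, tadd c' v).
  apply: eq_from_tnth => i; rewrite tnth_mktuple.
  case: (unliftP ord0 i) => [j ->|->]; last by rewrite !tnth0.
  by rewrite !tnthS tnth_mktuple.
have cmE z v : cameron_martin c (tcons (z, v)) =
    expR (c ord0 * z - c ord0 ^+ 2 / 2) * cameron_martin c' v.
  rewrite /cameron_martin -expRD big_ord_recl tnth0; congr (expR (_ + _)).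
  by apply: eq_bigr => i _; rewrite tnthS.
pose e (z : R) := expR (c ord0 * z - c ord0 ^+ 2 / 2).
have me : measurable_fun setT (fun z => (e z)%:E).
  by apply/measurable_EFinP/measurableT_comp => //; exact: measurable_funB.
rewrite ge0_integral_gaussnS//; last exact: (measurableT_comp mf (measurable_tadd c)).
rewrite ge0_integral_gaussnS; last 2 first.
- by apply: emeasurable_funM => //; exact: mcm.
- by move=> v; rewrite mule_ge0// lee_fin expR_ge0.
(* Half-way integrand: the shift of the head has become a density, the tail is still shifted.
   Tonelli is then applied with the head innermost to reach [g], and with the tail innermost to
   leave it. *)
pose g (p : R * n.-tuple R) := (f (tcons (p.1, tadd c' p.2)) * (e p.1)%:E)%E.
have mg : measurable_fun setT g.
  apply: emeasurable_funM; last exact: (measurableT_comp me).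
  apply: (measurableT_comp mft); apply: measurable_fun_pair => //.
  exact: (measurableT_comp (measurable_tadd c')).
have g0 p : (0 <= g p)%E by rewrite mule_ge0// lee_fin expR_ge0.
transitivity (\int[(gauss \x gaussn n)%E]_p g p)%E.
  have mft' : measurable_fun setT (fun p : R * n.-tuple R => f (tadd c (tcons p))).
    apply: (measurableT_comp mf); apply: (measurableT_comp (measurable_tadd c)).
    exact: measurable_tcons.
  rewrite (fubini_tonelli2 _ mft' (fun p => f0 _)) (fubini_tonelli2 g mg g0).
  apply: eq_integral => v _; rewrite /fubini_G.
  under eq_integral do rewrite taddE.
  apply: (@gauss_shift _ (c ord0) (fun z => f (tcons (z, tadd c' v)))); last first.
    by move=> z; exact: f0.
  exact: (measurableT_comp mft (pair2_measurable _)).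
pose h (p : R * n.-tuple R) := (f (tcons p) * (cameron_martin c (tcons p))%:E)%E.
have mh : measurable_fun setT h.
  apply: emeasurable_funM => //.
  exact: (measurableT_comp (mcm _ c) (@measurable_tcons n)).
have h0 p : (0 <= h p)%E by rewrite mule_ge0// lee_fin expR_ge0.
rewrite (fubini_tonelli1 g mg g0) (fubini_tonelli1 h mh h0).
apply: eq_integral => z _; rewrite /fubini_F.
have mfz := measurableT_comp mft (pair1_measurable z).
have ez0 : (0 <= (e z)%:E)%E by rewrite lee_fin expR_ge0.
transitivity ((\int[gaussn n]_v f (tcons (z, tadd c' v))) * (e z)%:E)%E.
  rewrite /g /= ge0_integralZr//.
  exact: (measurableT_comp mfz (measurable_tadd c')).
rewrite (IHn c' (fun v => f (tcons (z, v))) mfz (fun v => f0 _)).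
rewrite -ge0_integralZr//; last 2 first.
- by apply: emeasurable_funM => //; exact: mcm.
- by move=> v _; rewrite mule_ge0// lee_fin expR_ge0.
by apply: eq_integral => v _; rewrite /h cmE -/(e z) EFinM muleA muleAC.
Qed.

End gaussian_product.

Lemma big_ord_enum (S : Type) (idx : S) (op : Monoid.com_law idx) (I : finType)
    (F : I -> S) :
  \big[op/idx]_(i : I) F i = \big[op/idx]_(k < #|I|) F (enum_val k).
Proof. exact/reindex/onW_bij/enum_val_bij. Qed.

Section gaussian_vector.
Variables (R : realType) (I : finType).
Local Notation gauss := (@gauss R).
Local Notation vec := (#|I|.-tuple R).

(** Coordinates are indexed by an arbitrary finite type, so that matrix entries and disjoint unions
    of families need no arithmetic on indices. *)
Definition crd (i : I) (v : vec) : R := tnth v (enum_rank i).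

Definition tup (x : I -> R) : vec := [tuple x (enum_val k) | k < #|I|].

Lemma crd_tup x i : crd i (tup x) = x i.
Proof. by rewrite /crd tnth_mktuple enum_rankK. Qed.

Lemma measurable_crd i : measurable_fun setT (crd i).
Proof. exact: measurable_tnth. Qed.

Lemma measurable_tup d (T : measurableType d) (X : T -> I -> R) :
  (forall i, measurable_fun setT (X^~ i)) -> measurable_fun setT (fun t => tup (X t)).
Proof.
move=> mX; apply/measurable_fun_tnthP => k.
rewrite (_ : _ \o _ = X^~ (enum_val k)); first exact: mX.
by apply/funext => t /=; rewrite tnth_mktuple.
Qed.

Definition gaussv : probability vec R := gaussn R #|I|.

Lemma ge0_integral_gaussv_law d (T : measurableType d) (P : probability T R)
    (X : T -> I -> R) (f : vec -> \bar R) :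
  (forall i, measurable_fun setT (X^~ i)) ->
  (forall A : I -> set R, (forall i, measurable (A i)) ->
     P [set t | forall i, A i (X t i)] = (\prod_(i : I) gauss (A i))%E) ->
  measurable_fun setT f -> (forall v, 0 <= f v)%E ->
  (\int[gaussv]_v f v = \int[P]_t f (tup (X t)))%E.
Proof.
move=> mX PX mf f0; apply: ge0_integral_gaussn_law => //; first exact: measurable_tup.
move=> A mA; rewrite (eq_bigr (fun k => gauss (A (enum_rank (enum_val k))))); last first.
  by move=> k _; rewrite enum_valK.
rewrite -(big_ord_enum _ (fun i => gauss (A (enum_rank i)))) -PX//.
congr (P _); apply/seteqP; split => t /= At i.
  by have := At (enum_rank i); rewrite tnth_mktuple enum_rankK.
by have := At (enum_val i); rewrite tnth_mktuple enum_valK.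
Qed.

Lemma gaussv_box (A : I -> set R) : (forall i, measurable (A i)) ->
  gaussv [set v | forall i, A i (crd i v)] = (\prod_(i : I) gauss (A i))%E.
Proof.
move=> mA; rewrite big_ord_enum -gaussn_box//.
congr (gaussv _); apply/seteqP; split => v /= Av i.
  by have := Av (enum_val i); rewrite /crd enum_valK.
by have := Av (enum_rank i); rewrite enum_rankK.
Qed.

Lemma ge0_integral_gaussv_prod (f : I -> R -> R) :
  (forall i, measurable_fun setT (f i)) -> (forall i z, 0 <= f i z) ->
  (\int[gaussv]_v (\prod_(i : I) f i (crd i v))%:E =
   \prod_(i : I) \int[gauss]_z (f i z)%:E)%E.
Proof.
move=> mf f0; rewrite [RHS]big_ord_enum -ge0_integral_gaussn_prod//.
apply: eq_integral => v _; rewrite big_ord_enum; congr _%:E.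
by apply: eq_bigr => k _; rewrite /crd enum_valK.
Qed.

Lemma gaussv_shift (c : I -> R) (f : vec -> \bar R) :
  measurable_fun setT f -> (forall v, 0 <= f v)%E ->
  (\int[gaussv]_v f (tup (fun i => crd i v + c i)%R) =
   \int[gaussv]_v (f v * (expR (\sum_i (c i * crd i v - c i ^+ 2 / 2)))%:E))%E.
Proof.
move=> mf f0; have := @gaussn_shift R _ (c \o enum_val) f mf f0.
rewrite (_ : tadd (c \o enum_val) = fun v => tup (fun i => crd i v + c i)); last first.
  apply/funext => v; apply: eq_from_tnth => k.
  by rewrite !tnth_mktuple /crd enum_valK.
move=> ->; apply: eq_integral => v _; congr (_ * (expR _)%:E)%E.
rewrite [RHS]big_ord_enum.
by apply: eq_bigr => k _; rewrite /crd enum_valK.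
Qed.

Lemma gaussv_flip (S : pred I) (f : vec -> \bar R) :
  measurable_fun setT f -> (forall v, 0 <= f v)%E ->
  (\int[gaussv]_v f (tup (fun i => if S i then - crd i v else crd i v)%R) =
   \int[gaussv]_v f v)%E.
Proof.
move=> mf f0; apply/esym/ge0_integral_gaussv_law => // [i|A mA].
  by case: (S i); [exact: (measurable_funN (measurable_crd i))|exact: measurable_crd].
have mNA i : measurable (-%R @^-1` A i : set R).
  by rewrite -[X in measurable X]setTI; exact: measurable_funN.
pose B i : set R := if S i then -%R @^-1` A i else A i.
rewrite (_ : [set v | _] = [set v | forall i, B i (crd i v)]); last first.
  by apply/seteqP; split => v /= Av i; have := Av i; rewrite /B; case: ifP.
rewrite gaussv_box; last by move=> i; rewrite /B; case: ifP.
by apply: eq_bigr => i _; rewrite /B; case: ifP => // _; rewrite gaussN.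
Qed.

(** This plays the role of conditioning: the coordinates in [S] are resampled independently while
    the others stay frozen at [u]. On boxes both sides factor over the coordinates. *)
Lemma gaussv_mix (S : pred I) (f : vec -> \bar R) :
  measurable_fun setT f -> (forall v, 0 <= f v)%E ->
  (\int[gaussv]_v f v = \int[gaussv]_u \int[gaussv]_v
     f (tup (fun i => if S i then crd i v else crd i u)))%E.
Proof.
move=> mf f0.
pose X (p : vec * vec) i := if S i then crd i p.2 else crd i p.1.
have mX i : measurable_fun setT (X^~ i).
  by rewrite /X; case: (S i); exact: (measurableT_comp (measurable_crd i)).
rewrite -(@fubini_tonelli1 _ _ _ _ _ gaussv gaussv (f \o tup \o X)); last 2 first.
- exact: (measurableT_comp mf (measurable_tup mX)).
- by move=> p; exact: f0.
apply: (@ge0_integral_gaussv_law _ _ (gaussv \x gaussv)%E X) => // A mA.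
pose B1 i : set R := if S i then setT else A i.
pose B2 i : set R := if S i then A i else setT.
have mB1 i : measurable (B1 i) by rewrite /B1; case: ifP.
have mB2 i : measurable (B2 i) by rewrite /B2; case: ifP.
have mbox (B : I -> set R) : (forall i, measurable (B i)) ->
    measurable [set v : vec | forall i, B i (crd i v)].
  move=> mB; rewrite (_ : mkset _ = \bigcap_(i in [set: I]) (crd i @^-1` B i)).
    apply: fin_bigcap_measurable => // i _.
    by rewrite -[X in measurable X]setTI; exact: measurable_crd.
  by apply/seteqP; split => [v Bv i _|v Bv i]; exact: Bv.
rewrite (_ : [set t | _] = [set v | forall i, B1 i (crd i v)] `*`
    [set v | forall i, B2 i (crd i v)]); last first.
  apply/seteqP; split => [[u v] /= Av|[u v] [/= B1u B2v] i].
    by split => i; have := Av i; rewrite /X /B1 /B2; case: ifP.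
  by have := B1u i; have := B2v i; rewrite /X /B1 /B2; case: ifP.
apply: etrans; first by apply: product_measure1E; exact: mbox.
rewrite /= !gaussv_box// -big_split; apply: eq_bigr => i _ /=.
by rewrite /B1 /B2; case: ifP => _; rewrite probability_setT ?mul1e ?mule1.
Qed.

Lemma ge0_integral_gaussv_iid d (T : measurableType d) (P : probability T R)
    (G : I -> {RV P >-> R}) (f : vec -> \bar R) :
  mutually_independent G -> (forall i, standard_gaussian (G i)) ->
  measurable_fun setT f -> (forall v, 0 <= f v)%E ->
  (\int[gaussv]_v f v = \int[P]_t f (tup (fun i => G i t)))%E.
Proof.
move=> indG gG mf f0; apply: ge0_integral_gaussv_law => // A mA.
have := indG [set: I]%SET A mA.
rewrite (_ : \bigcap_(i in _) _ = [set t | forall i, A i (G i t)]); last first.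
  apply/seteqP; split => t At i; last by move=> _; exact: At.
  by apply: At => /=; rewrite inE.
move=> ->; apply: eq_big => [i|i _]; first by rewrite inE.
exact: gG.
Qed.

End gaussian_vector.

(** Enlarges the space by independent coordinates; this is how the auxiliary Gaussian variables are
    adjoined to [G]. *)
Lemma ge0_integral_gaussv_inl (R : realType) (J K : finType)
    (f : #|J|.-tuple R -> \bar R) :
  measurable_fun setT f -> (forall v, 0 <= f v)%E ->
  (\int[gaussv R J]_v f v =
   \int[gaussv R (J + K)%type]_v f (tup (fun j => crd (inl j) v)))%E.
Proof.
move=> mf f0; apply: ge0_integral_gaussv_law => // [j|A mA].
  exact: measurable_crd.
pose B (i : J + K) : set R := if i is inl j then A j else setT.
rewrite (_ : [set v | _] = [set v | forall i, B i (crd i v)]); last first.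
  apply/seteqP; split => v /= Av i; last exact: (Av (inl i)).
  by case: i => // j; exact: Av.
rewrite gaussv_box; last by case=> [j|k]; [exact: mA|exact: measurableT].
rewrite big_sumType /= [X in (_ * X)%E]big1 ?mule1// => k _.
by rewrite probability_setT.
Qed.

(** * Soft maxima *)

Section soft_maximum.
Variables (R : realType) (K : finType).
Hypothesis K0 : (0 < #|K|)%N.

Definition sumexp (y : K -> R) : R := \sum_k expR (y k).
(** A smooth substitute for the maximum, which it exceeds by at most ln #|K| ([lse_ge], [lse_le]);
    [softmax] is its gradient. *)
Definition lse (y : K -> R) : R := ln (sumexp y).
Definition softmax (y : K -> R) (k : K) : R := expR (y k) / sumexp y.

Lemma sumexp_gt0 y : 0 < sumexp y.
Proof.
have [k _] := (card_gt0P K0).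
by rewrite /sumexp (bigD1 k)//= ltr_wpDr ?expR_gt0// sumr_ge0// => i _; rewrite expR_ge0.
Qed.

Lemma expR_le_sumexp y k : expR (y k) <= sumexp y.
Proof. by rewrite /sumexp (bigD1 k)//= lerDl sumr_ge0// => i _; rewrite expR_ge0. Qed.

Lemma softmax_ge0 y k : 0 <= softmax y k.
Proof. by rewrite divr_ge0 ?expR_ge0// ltW// sumexp_gt0. Qed.

Lemma softmax_le1 y k : softmax y k <= 1.
Proof. by rewrite ler_pdivrMr ?sumexp_gt0// mul1r expR_le_sumexp. Qed.

Lemma lse_ge y k : y k <= lse y.
Proof. by rewrite -[leLHS]expRK ler_ln ?posrE ?expR_gt0 ?sumexp_gt0// expR_le_sumexp. Qed.

Lemma lse_le y m : (forall k, y k <= m) -> lse y <= ln #|K|%:R + m.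
Proof.
move=> ym; rewrite -[leRHS]expRK ler_ln ?posrE ?expR_gt0 ?sumexp_gt0//.
rewrite expRD lnK ?posrE ?ltr0n// mulr_natl -sumr_const.
by apply: ler_sum => k _; rewrite ler_expR.
Qed.

Lemma is_derive_lse (y : R -> K -> R) (m : K -> R) (x : R) :
  (forall k, is_derive x 1 (y^~ k) (m k)) ->
  is_derive x 1 (fun t => lse (y t)) (\sum_k softmax (y x) k * m k).
Proof.
move=> ym.
have ye k : is_derive x 1 (fun t => expR (y t k)) (expR (y x k) * m k).
  exact: (is_derive1_comp (is_derive_expR _) (ym k)).
have ys : is_derive x 1 (fun t => sumexp (y t)) (\sum_k expR (y x k) * m k).
  rewrite (_ : (fun t => _) = \sum_(i < #|K|) (fun t => expR (y t (enum_val i)))); last first.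
    by apply/funext => t; rewrite /sumexp big_ord_enum fct_sumE.
  rewrite [X in is_derive _ _ _ X]big_ord_enum.
  by apply: is_derive_sum => i; exact: ye.
have := is_derive1_comp (is_derive1_ln (sumexp_gt0 (y x))) ys.
rewrite mulr_sumr; under eq_bigr do rewrite mulrA (mulrC _^-1).
by [].
Qed.

End soft_maximum.

(** * Gaussian integrals of exponentially bounded functions *)

Section gaussian_exponential.
Variable R : realType.
Local Notation gauss := (@gauss R).

Lemma gauss_expR (s : R) :
  (\int[gauss]_z (expR (s * z))%:E = (expR (s ^+ 2 / 2))%:E)%E.
Proof.
have me : measurable_fun setT (fun z : R => expR (s * z)).
  by apply: measurableT_comp => //; exact: measurable_funM.
have := @gauss_shift _ s (fun _ : R => (expR (s ^+ 2 / 2))%:E) (measurable_cst _).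
rewrite integral_cst//= probability_setT mule1.
move=> ->; last by move=> z; rewrite lee_fin expR_ge0.
by apply: eq_integral => z _; rewrite -EFinM -expRD; congr (expR _)%:E; ring.
Qed.

Lemma gauss_expR_norm (s : R) :
  (\int[gauss]_z (expR (s * `|z|))%:E <= (2 * expR (s ^+ 2 / 2))%:E)%E.
Proof.
have me (r : R) : measurable_fun setT (fun z : R => (expR (r * z))%:E).
  by apply/measurable_EFinP; apply: measurableT_comp => //; exact: measurable_funM.
rewrite (_ : (2 * _)%:E = \int[gauss]_z ((expR (s * z))%:E + (expR (- s * z))%:E))%E.
  apply: ge0_le_integral => //.
  - apply/measurable_EFinP; apply: measurableT_comp => //.
    by apply: measurable_funM => //; exact: measurableT_comp.
  - by apply: emeasurable_funD.
  - move=> z _; rewrite -EFinD lee_fin.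
    have [z0|z0] := leP 0 z; first by rewrite ger0_norm// lerDl expR_ge0.
    by rewrite ltr0_norm// mulrN mulNr lerDr expR_ge0.
rewrite ge0_integralD//.
by rewrite !gauss_expR sqrrN -EFinD; congr _%:E; ring.
Qed.

Variable I : finType.
Local Notation vec := (#|I|.-tuple R).
Local Notation E := (@gaussv R I).

Definition dotv (c : I -> R) (v : vec) : R := \sum_i c i * crd i v.

Definition norm1 (v : vec) : R := \sum_i `|crd i v|.

Lemma measurable_dotv c : measurable_fun setT (dotv c).
Proof.
by apply: measurable_sum => i; apply: measurable_funM => //; exact: measurable_crd.
Qed.

Lemma norm1_ge0 v : 0 <= norm1 v.
Proof. by rewrite sumr_ge0. Qed.

Lemma measurable_norm1 : measurable_fun setT norm1.
Proof.
by apply: measurable_sum => i; apply: measurableT_comp => //; exact: measurable_crd.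
Qed.

Lemma dotv_le (c : I -> R) B v : (forall i, `|c i| <= B) -> `|dotv c v| <= B * norm1 v.
Proof.
move=> cB; rewrite mulr_sumr (le_trans (ler_norm_sum _ _ _))// ler_sum// => i _.
by rewrite normrM ler_wpM2r.
Qed.

Lemma integrable_expR_norm1 (s : R) : E.-integrable setT (fun v => (expR (s * norm1 v))%:E).
Proof.
have ms : measurable_fun setT (fun v => expR (s * norm1 v)).
  by apply: measurableT_comp => //; apply: measurable_funM => //; exact: measurable_norm1.
apply/integrableP; split; first exact/measurable_EFinP.
under eq_integral do rewrite abse_EFin ger0_norm ?expR_ge0// mulr_sumr expR_sum.
rewrite (@ge0_integral_gaussv_prod R I (fun _ z => expR (s * `|z|))); last 2 first.
- by move=> i; apply: measurableT_comp => //; exact: measurable_funM.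
- by move=> i z; exact: expR_ge0.
suff /andP[] : (0 <= \prod_(i : I) \int[gauss]_z (expR (s * `|z|))%:E < +oo)%E by [].
elim/big_ind : _ => [|x y /andP[x0 xy] /andP[y0 yy]|i _].
- by rewrite lee01 ltry.
- by rewrite mule_ge0//= lte_mul_pinfty// ge0_fin_numE.
- rewrite (le_lt_trans (gauss_expR_norm s)) ?ltry// andbT.
  by apply: integral_ge0 => z _; rewrite lee_fin expR_ge0.
Qed.

(** The growth class used for domination: its measurable members are integrable, and it is stable
    under products and translations. *)
Definition expbounded (f : vec -> R) := exists C s, forall v, `|f v| <= C * expR (s * norm1 v).

Lemma integrable_expbounded (f : vec -> R) : measurable_fun setT f -> expbounded f ->
  E.-integrable setT (EFin \o f).
Proof.
move=> mf [C [s fC]].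
apply: (@le_integrable _ _ _ _ _ measurableT _ (fun v => C%:E * (expR (s * norm1 v))%:E)%E).
- exact/measurable_EFinP.
- move=> v _; rewrite -EFinM !abse_EFin lee_fin.
  by rewrite (le_trans (fC v))// ler_norm.
- by apply: integrableZl => //; exact: integrable_expR_norm1.
Qed.

(** The bound on the derivative is required only for [x] within distance 1 of [a], because
    translating by a multiple [s] of a vector costs a factor that grows with |s|. *)
Lemma is_derive_expectation (f df : R -> vec -> R) (a C s : R) :
  (forall x, measurable_fun setT (f x)) -> (forall x, expbounded (f x)) ->
  (forall (x : R) v, is_derive x 1 (f^~ v) (df x v)) ->
  (forall x v, `|x - a| < 1 -> `|df x v| <= C * expR (s * norm1 v)) ->
  is_derive a 1 (fun x => \int[E]_v f x v) (\int[E]_v df a v).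
Proof.
move=> mf bf ddf bdf.
have Ia : `]a - 1, a + 1[%classic a by rewrite /= in_itv/= ltrBlDr ltrDl ltr01.
have dE x v : partial1of2 f x v = df x v.
  by rewrite partial1of2E; have [_ ->] := ddf x v.
have intf x : `]a - 1, a + 1[%classic x -> E.-integrable setT (EFin \o f x).
  by move=> _; apply: integrable_expbounded.
have derf x v : `]a - 1, a + 1[%classic x -> setT v -> derivable (f^~ v) x 1.
  by move=> _ _; have [] := ddf x v.
have G0 v : 0 <= `|C| * expR (s * norm1 v) by rewrite mulr_ge0// expR_ge0.
have intG : E.-integrable setT (EFin \o (fun v => `|C| * expR (s * norm1 v))).
  apply: integrable_expbounded.
    apply: measurable_funM => //; apply: measurableT_comp => //.
    by apply: measurable_funM => //; exact: measurable_norm1.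
  by exists `|C|, s => v; rewrite ger0_norm.
have Gub x v : `]a - 1, a + 1[%classic x -> setT v ->
    `|partial1of2 f x v| <= `|C| * expR (s * norm1 v).
  move=> xa _; rewrite dE (le_trans (bdf x v _))//.
    by rewrite ltr_distl; move: xa; rewrite /= in_itv/=.
  by rewrite ler_wpM2r ?expR_ge0// ler_norm.
have d1 := derivable_under_integral measurableT Ia intf derf G0 intG Gub.
have d2 := differentiation_under_integral measurableT Ia intf derf G0 intG Gub.
apply: DeriveDef => //.
by rewrite -derive1E d2; apply: eq_Rintegral => v _; exact: dE.
Qed.

End gaussian_exponential.

(** * Gaussian integration by parts *)

Section gaussian_integration_by_parts.
Variables (R : realType) (I : finType).
Local Notation vec := (#|I|.-tuple R).
Local Notation E := (@gaussv R I).

Definition shiftv (c : I -> R) (s : R) (v : vec) : vec := tup (fun i => crd i v + s * c i).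

Lemma measurable_shiftv c s : measurable_fun setT (shiftv c s).
Proof.
by apply: measurable_tup => i; apply: measurable_funD => //; exact: measurable_crd.
Qed.

Lemma norm1_shiftv c s v : norm1 (shiftv c s v) <= norm1 v + `|s| * \sum_i `|c i|.
Proof.
rewrite /norm1 mulr_sumr -big_split/=; apply: ler_sum => i _.
by rewrite crd_tup (le_trans (ler_normD _ _))// normrM.
Qed.

Lemma dotv_shiftv l c s v : dotv l (shiftv c s v) = dotv l v + s * \sum_i l i * c i.
Proof.
rewrite /dotv mulr_sumr -big_split/=; apply: eq_bigr => i _.
by rewrite crd_tup mulrDr mulrCA.
Qed.

Lemma expbounded_shiftv (f : vec -> R) c s : expbounded f -> expbounded (f \o shiftv c s).
Proof.
move=> [C [r fC]]; exists (`|C| * expR (`|r| * (`|s| * \sum_i `|c i|))), `|r| => v /=.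
rewrite (le_trans (fC _))// (le_trans (ler_norm _))// normrM -mulrA ler_wpM2l//.
rewrite ger0_norm ?expR_ge0// -expRD ler_expR -mulrDr addrC.
rewrite (le_trans (ler_norm _))// normrM ler_wpM2l// ger0_norm ?norm1_ge0//.
exact: norm1_shiftv.
Qed.

Lemma expbounded_mul (f g : vec -> R) : expbounded f -> expbounded g ->
  expbounded (fun v => f v * g v).
Proof.
move=> [C [r fC]] [D [s gD]]; exists (C * D), (r + s) => v.
by rewrite normrM mulrDl expRD mulrACA ler_pM.
Qed.

Lemma expbounded_dotv (c : I -> R) : expbounded (dotv c).
Proof.
exists (\sum_i `|c i|), 1 => v; rewrite mul1r.
rewrite (le_trans (@dotv_le _ _ c (\sum_i `|c i|) v _))//.
  by move=> i; rewrite (bigD1 i)//= lerDl sumr_ge0.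
rewrite ler_wpM2l ?sumr_ge0// (le_trans _ (expR_ge1Dx _))//.
by rewrite lerDr.
Qed.

Lemma expbounded_expR_dotv (c : I -> R) : expbounded (fun v => expR (dotv c v)).
Proof.
exists 1, (\sum_i `|c i|) => v; rewrite mul1r ger0_norm ?expR_ge0// ler_expR.
rewrite (le_trans (ler_norm _))// dotv_le// => i.
by rewrite (bigD1 i)//= lerDl sumr_ge0.
Qed.

Lemma eq_Rintegral_EFin (f g : vec -> R) :
  (\int[E]_v (f v)%:E = \int[E]_v (g v)%:E)%E -> \int[E]_v f v = \int[E]_v g v.
Proof. by rewrite /Rintegral => ->. Qed.

Lemma gaussv_shiftv (c : I -> R) (s : R) (g : vec -> R) :
  measurable_fun setT g -> (forall v, 0 <= g v) ->
  \int[E]_v g (shiftv c s v) =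
  \int[E]_v (g v * expR (s * dotv c v - s ^+ 2 * (\sum_i c i ^+ 2) / 2)).
Proof.
move=> mg g0; apply: eq_Rintegral_EFin.
have := @gaussv_shift R I (fun i => s * c i) (EFin \o g) _ (fun v => _).
rewrite /= => -> //; last by exact/measurable_EFinP.
apply: eq_integral => v _; rewrite -EFinM; congr (_ * expR _)%:E.
rewrite big_split/= sumrN; congr (_ - _).
  by rewrite mulr_sumr; apply: eq_bigr => i _; rewrite mulrA.
by rewrite -mulr_suml mulr_sumr; congr (_ / _); apply: eq_bigr => i _; rewrite exprMn.
Qed.

(* Both sides are the derivative at [0] of [s |-> E (g (v + s c))]; on the left
   the shift has first been transferred to the Gaussian density. *)
Lemma gaussian_ibp (c : I -> R) (g : vec -> R) (dg : R -> vec -> R) C r :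
  measurable_fun setT g -> (forall v, 0 <= g v) -> expbounded g ->
  (forall (s : R) v, is_derive s 1 (fun x => g (shiftv c x v)) (dg s v)) ->
  (forall s v, `|s| < 1 -> `|dg s v| <= C * expR (r * norm1 v)) ->
  \int[E]_v (g v * dotv c v) = \int[E]_v dg 0 v.
Proof.
move=> mg g0 bg dgE bdg.
pose q : R := \sum_i c i ^+ 2.
pose e s v := expR (s * dotv c v - s ^+ 2 * q / 2).
have q0 : 0 <= q by rewrite sumr_ge0// => i _; exact: sqr_ge0.
have d1 : is_derive (0 : R) 1 (fun x => \int[E]_v g (shiftv c x v)) (\int[E]_v dg 0 v).
  apply: (@is_derive_expectation R I (fun x v => g (shiftv c x v)) dg 0 C r).
  - by move=> x; apply: (measurableT_comp mg); exact: measurable_shiftv.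
  - by move=> x; exact: expbounded_shiftv.
  - by move=> x v; rewrite subr0; exact: bdg.
pose de s v := (dotv c v - s * q) * e s v.
have deE (s : R) v : is_derive s 1 (e^~ v) (de s v).
  rewrite /de mulrC; apply: is_derive1_comp.
  by apply: is_derive_eq; rewrite /GRing.scale/=; field.
have be s : expbounded (e s).
  have [C1 [r1 e1]] := expbounded_expR_dotv (fun i => s * c i).
  exists C1, r1 => v; rewrite (le_trans _ (e1 v))// !ger0_norm ?expR_ge0// ler_expR.
  rewrite lerBlDr {1}/dotv mulr_sumr (eq_bigr (fun i => s * c i * crd i v)).
    by rewrite lerDl divr_ge0// mulr_ge0// sqr_ge0.
  by move=> i _; rewrite mulrA.
have [C1 [r1 g1]] := bg.
pose B := \sum_i `|c i|.
have dB v : `|dotv c v| <= B * norm1 v.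
  by apply: dotv_le => i; rewrite /B (bigD1 i)//= lerDl sumr_ge0.
have B0 : 0 <= B by rewrite sumr_ge0.
have mge x : measurable_fun setT (fun v => g v * e x v).
  apply: measurable_funM => //; apply: measurableT_comp => //.
  by apply: measurable_funB => //; apply: measurable_funM => //; exact: measurable_dotv.
have bge x : expbounded (fun v => g v * e x v) by exact: expbounded_mul.
have dge (x : R) v : is_derive x 1 (fun x => g v * e x v) (g v * de x v).
  exact: (@is_deriveZ R R^o R^o (e^~ v) (g v) x 1 (de x v) (deE x v)).
(* In the exponent, [r1] comes from [g] and [B] from [e]; the 1 absorbs the linear factor
   [dotv c v - s * q] through 1 + x <= exp x. *)
have bdge s v : `|s - 0| < 1 ->
    `|g v * de s v| <= C1 * (B + q) * expR ((r1 + (1 + B)) * norm1 v).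
  rewrite subr0 => s1.
  rewrite normrM mulrDl expRD mulrACA ler_pM// /de normrM.
  rewrite [(1 + B) * _]mulrDl mul1r expRD mulrA ler_pM//.
    have n1 := norm1_ge0 v; have := expR_ge1Dx (norm1 v) => en.
    rewrite (le_trans (ler_normB _ _))// normrM (ger0_norm q0) mulrDl lerD//.
      by rewrite (le_trans (dB v))// ler_wpM2l//; lra.
    by rewrite mulrC ler_wpM2l//; lra.
  rewrite ger0_norm ?expR_ge0// ler_expR.
  have : s * dotv c v <= B * norm1 v.
    rewrite (le_trans (ler_norm _))// normrM -[leRHS]mul1r ler_pM//.
    exact: ltW.
  have : 0 <= s ^+ 2 * q / 2 by rewrite divr_ge0// mulr_ge0// sqr_ge0.
  lra.
have d2 := @is_derive_expectation R I (fun x v => g v * e x v) (fun x v => g v * de x v)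
  0 (C1 * (B + q)) (r1 + (1 + B)) mge bge dge bdge.
have : (fun x => \int[E]_v g (shiftv c x v)) = (fun x => \int[E]_v (g v * e x v)).
  by apply/funext => x; exact: gaussv_shiftv.
move=> eqf; have [_ <-] := d1; rewrite eqf; have [_ ->] := d2.
apply: eq_Rintegral => v _.
by rewrite /de /e !mul0r subr0 expr0n/= !mul0r subr0 expR0 mulr1.
Qed.

End gaussian_integration_by_parts.

(** * Slepian's comparison inequality *)

Section gaussian_lse.
Variables (R : realType) (I K : finType).
Hypothesis K0 : (0 < #|K|)%N.
Local Notation vec := (#|I|.-tuple R).

Lemma measurable_lse_dotv (c : K -> I -> R) :
  measurable_fun setT (fun v : vec => lse (fun k => dotv (c k) v)).
Proof.
apply: measurableT_comp => //; apply: measurable_sum => k.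
by apply: measurableT_comp => //; exact: measurable_dotv.
Qed.

Lemma expR_lse_dotv_le (c : K -> I -> R) (al B : R) (v : vec) :
  0 <= al -> (forall k i, `|c k i| <= B) ->
  expR (al * lse (fun k => dotv (c k) v)) <=
  expR (al * ln #|K|%:R) * expR (al * B * norm1 v).
Proof.
move=> al0 cB; rewrite -expRD ler_expR -mulrA -mulrDr ler_wpM2l// lse_le// => k.
by rewrite (le_trans (ler_norm _))// dotv_le.
Qed.

Lemma integrable_expR_lse_dotv (c : K -> I -> R) (al : R) : 0 <= al ->
  (@gaussv R I).-integrable setT (fun v => (expR (al * lse (fun k => dotv (c k) v)))%:E).
Proof.
move=> al0; apply: (@integrable_expbounded R I (fun v => expR (al * lse (fun k => dotv (c k) v)))).
  by apply: measurableT_comp => //; apply: measurable_funM => //; exact: measurable_lse_dotv.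
exists (expR (al * ln #|K|%:R)), (al * \sum_k \sum_i `|c k i|) => v.
rewrite ger0_norm ?expR_ge0// expR_lse_dotv_le// => k i.
rewrite (bigD1 k)//= (bigD1 i)//= -addrA lerDl addr_ge0// sumr_ge0// => *.
by rewrite sumr_ge0.
Qed.

End gaussian_lse.

Section slepian.
Variables (R : realType) (I K : finType).
Local Notation vec := (#|I|.-tuple R).
Local Notation E := (@gaussv R I).
Variables (a b : K -> I -> R) (al : R).
Hypothesis K0 : (0 < #|K|)%N.
Hypotheses (al0 : 0 <= al) (al1 : al <= 1).
Hypothesis eq_norm : forall k, \sum_i a k i ^+ 2 = \sum_i b k i ^+ 2.
Hypothesis le_cov : forall k j, \sum_i b k i * b j i <= \sum_i a k i * a j i.
Hypothesis orth : forall k j, \sum_i a k i * b j i = 0.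

(** Rotation from [a] at 0 to [b] at pi / 2; unlike square-root weights, it keeps the derivative
    [l'] bounded at both ends. *)
Let l (t : R) k i := cos t * a k i + sin t * b k i.
Let l' (t : R) k i := - sin t * a k i + cos t * b k i.
Let y (t : R) (v : vec) k := dotv (l t k) v.
Let B : R := \sum_k \sum_i (`|a k i| + `|b k i|).

Let abB k i : `|a k i| + `|b k i| <= B.
Proof.
rewrite /B (bigD1 k)//= (bigD1 i)//= -!addrA addrA lerDl.
by rewrite addr_ge0// !sumr_ge0// => *; rewrite ?sumr_ge0// => *; rewrite addr_ge0.
Qed.

Let B0 : 0 <= B.
Proof. by rewrite sumr_ge0// => k _; rewrite sumr_ge0// => i _; rewrite addr_ge0. Qed.

Let normr_cos (t : R) : `|cos t| <= 1.
Proof. by rewrite ler_norml cos_geN1 cos_le1. Qed.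

Let normr_sin (t : R) : `|sin t| <= 1.
Proof. by rewrite ler_norml sin_geN1 sin_le1. Qed.

Let lB t k i : `|l t k i| <= B.
Proof.
apply: le_trans (abB k i); rewrite (le_trans (ler_normD _ _))// !normrM.
by rewrite lerD// ler_piMl.
Qed.

Let l'B t k i : `|l' t k i| <= B.
Proof.
apply: le_trans (abB k i); rewrite (le_trans (ler_normD _ _))// !normrM normrN.
by rewrite lerD// ler_piMl.
Qed.

Let yE t v k : y t v k = cos t * dotv (a k) v + sin t * dotv (b k) v.
Proof.
rewrite /y /dotv !mulr_sumr -big_split; apply: eq_bigr => i _ /=.
by rewrite /l; ring.
Qed.

Let y'E t v k : dotv (l' t k) v = - sin t * dotv (a k) v + cos t * dotv (b k) v.
Proof.
rewrite /dotv !mulr_sumr -big_split; apply: eq_bigr => i _ /=.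
by rewrite /l'; ring.
Qed.

Let dy (t : R) v k : is_derive t 1 (fun x => y x v k) (dotv (l' t k) v).
Proof.
rewrite (_ : (fun x => _) = (fun x => cos x * dotv (a k) v + sin x * dotv (b k) v)).
  by rewrite y'E; apply: is_derive_eq; rewrite /GRing.scale/= ; ring.
by apply/funext => x; rewrite yE.
Qed.

Let F t v := expR (al * lse (y t v)).
(** This is [softmax] times [F] (see [gE]), written as one exponential so that its sign is evident
    and its derivative comes from the chain rule. *)
Let g t k v := expR (y t v k + (al - 1) * lse (y t v)).

Let gE t k v : g t k v = softmax (y t v) k * F t v.
Proof.
rewrite /g /F /softmax mulrBl mul1r addrCA expRD mulrC; congr (_ * _).
by rewrite expRB /lse lnK// posrE sumexp_gt0.
Qed.

Let F_le t v : F t v <= expR (al * ln #|K|%:R) * expR (al * B * norm1 v).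
Proof. exact: expR_lse_dotv_le. Qed.

Let C := expR (al * ln #|K|%:R) : R.
Let C0 : 0 <= C. Proof. exact: expR_ge0. Qed.

Let mlse t : measurable_fun setT (fun v => lse (y t v)).
Proof. exact: measurable_lse_dotv. Qed.

Let mF t : measurable_fun setT (F t).
Proof. by apply: measurableT_comp => //; apply: measurable_funM => //; exact: mlse. Qed.

Let mg t k : measurable_fun setT (g t k).
Proof.
apply: measurableT_comp => //; apply: measurable_funD; first exact: measurable_dotv.
by apply: measurable_funM => //; exact: mlse.
Qed.

Let g_ge0 t k v : 0 <= g t k v. Proof. exact: expR_ge0. Qed.

Let g_le t k v : g t k v <= C * expR (al * B * norm1 v).
Proof. by rewrite gE (le_trans _ (F_le t v))// ler_piMl ?expR_ge0// softmax_le1. Qed.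

Let bF t : expbounded (F t).
Proof. by exists C, (al * B) => v; rewrite ger0_norm ?expR_ge0. Qed.

Let bg t k : expbounded (g t k).
Proof. by exists C, (al * B) => v; rewrite ger0_norm. Qed.

(** Covariance of [y t j] with the derivative process at [k]. By orthogonality it reduces to cos t
    sin t times the difference of the two covariances, and equality of variances kills its
    diagonal. *)
Let M t k j := \sum_i l t j i * l' t k i.

Let ME t k j : M t k j = cos t * sin t *
  (\sum_i b k i * b j i - \sum_i a k i * a j i).
Proof.
transitivity (cos t * sin t * (\sum_i b k i * b j i - \sum_i a k i * a j i) +
   cos t ^+ 2 * (\sum_i a j i * b k i) - sin t ^+ 2 * (\sum_i a k i * b j i)).
  rewrite !mulrBr !mulr_sumr -!sumrN -!big_split; apply: eq_bigr => i _ /=.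
  by rewrite /l /l'; ring.
by rewrite !orth !mulr0 addr0 subr0.
Qed.

Let Mkk t k : M t k k = 0.
Proof.
rewrite ME; have := eq_norm k; under eq_bigr do rewrite expr2.
by under [RHS]eq_bigr do rewrite expr2; move=> ->; rewrite subrr mulr0.
Qed.

Let phi t := \int[E]_v F t v.

Let dF (t : R) v := al * \sum_k (g t k v * dotv (l' t k) v).

Let dFE (t : R) v : is_derive t 1 (F^~ v) (dF t v).
Proof.
have h1 := @is_derive_lse R K K0 (fun x => y x v) (fun k => dotv (l' t k) v) t (fun k => dy t v k).
have h2 := @is_deriveZ R R^o R^o _ al _ _ _ h1.
have := @is_derive1_comp R expR (fun x => al * lse (y x v)) t _ _ (is_derive_expR _) h2.
rewrite (_ : expR _ * _ = dF t v)// /dF /GRing.scale/= mulrCA; congr (_ * _).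
by rewrite mulr_sumr; apply: eq_bigr => k _; rewrite gE /F; ring.
Qed.

Let bdF t v : `|dF t v| <= C * #|K|%:R * B * expR ((al * B + 1) * norm1 v).
Proof.
rewrite /dF normrM (ger0_norm al0).
rewrite (@le_trans _ _ (\sum_(k : K) C * expR (al * B * norm1 v) * (B * expR (norm1 v))))//.
  rewrite (le_trans (ler_piMl _ al1))// (le_trans (ler_norm_sum _ _ _))//.
  apply: ler_sum => k _; rewrite normrM ler_pM//; first by rewrite ger0_norm.
  rewrite (le_trans (dotv_le v (l'B t k)))// ler_wpM2l//.
  by rewrite (le_trans _ (expR_ge1Dx _))// lerDr.
rewrite sumr_const mulrDl mul1r expRD -mulr_natr.
by rewrite le_eqVlt; apply/orP; left; apply/eqP; ring.
Qed.

Let dphi (t : R) : is_derive t 1 phi (\int[E]_v dF t v).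
Proof.
exact: (@is_derive_expectation R I F dF t _ _ mF bF dFE (fun x v _ => bdF x v)).
Qed.

(** Derivative of [g t k] along [l' t k], the direction in which integration by parts is applied.
    Differentiating the linear part of the exponent gives [M t k k]; differentiating the soft
    maximum gives the weighted sum. *)
Let dg t k (s : R) v := g t k (shiftv (l' t k) s v) *
  (M t k k + (al - 1) * \sum_j softmax (y t (shiftv (l' t k) s v)) j * M t k j).

Let dgE t k (s : R) v : is_derive s 1 (fun x => g t k (shiftv (l' t k) x v)) (dg t k s v).
Proof.
have h0 j : is_derive s 1 (fun x => y t (shiftv (l' t k) x v) j) (M t k j).
  rewrite (_ : (fun x => _) = (fun x => dotv (l t j) v + x * M t k j)); last first.
    by apply/funext => x; rewrite /y dotv_shiftv.
  by apply: is_derive_eq; rewrite /GRing.scale/=; ring.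
have h1 := @is_derive_lse R K K0 (fun x => y t (shiftv (l' t k) x v)) (M t k) s h0.
have h2 := @is_deriveZ R R^o R^o _ (al - 1) _ _ _ h1.
exact: (@is_derive1_comp R expR (fun x => y t (shiftv (l' t k) x v) k +
  (al - 1) * lse (y t (shiftv (l' t k) x v))) s _ _ (is_derive_expR _) (is_deriveD (h0 k) h2)).
Qed.

Let bM t k j : `|M t k j| <= B ^+ 2 *+ #|I|.
Proof.
rewrite (le_trans (ler_norm_sum _ _ _))// -sumr_const; apply: ler_sum => i _.
by rewrite normrM expr2 ler_pM.
Qed.

Let bdg t k : exists D r, forall s v, `|s| < 1 -> `|dg t k s v| <= D * expR (r * norm1 v).
Proof.
pose q := B ^+ 2 *+ #|I|; have q0 : 0 <= q by rewrite mulrn_wge0// sqr_ge0.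
exists (C * expR (al * B * (\sum_i `|l' t k i|)) * (q + q)), (al * B) => s v s1.
rewrite /dg normrM mulrAC ler_pM//.
  rewrite ger0_norm// (le_trans (g_le _ _ _))// -[leRHS]mulrA ler_wpM2l// -expRD ler_expR.
  rewrite -mulrDr ler_wpM2l ?mulr_ge0//.
  rewrite (le_trans (norm1_shiftv _ _ _))// addrC lerD2r ler_piMl ?sumr_ge0//.
  exact: ltW.
rewrite (le_trans (ler_normD _ _))// lerD ?bM// normrM.
have : `|al - 1| <= 1.
  by rewrite ler_norml; apply/andP; split; move: al0 al1; lra.
move=> h; rewrite -[leRHS]mul1r ler_pM// (le_trans (ler_norm_sum _ _ _))//.
set z := shiftv _ _ _.
have : \sum_j softmax (y t z) j = 1.
  by rewrite /softmax -mulr_suml divff// gt_eqF// sumexp_gt0.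
move=> hz; rewrite -[leRHS]mul1r -hz mulr_suml; apply: ler_sum => j _.
by rewrite normrM ger0_norm ?softmax_ge0// ler_wpM2l ?softmax_ge0// bM.
Qed.

Let ibp t k : \int[E]_v (g t k v * dotv (l' t k) v) = \int[E]_v dg t k 0 v.
Proof.
have [D [r hD]] := bdg t k.
exact: (@gaussian_ibp R I (l' t k) (g t k) (dg t k) D r (mg t k) (g_ge0 t k) (bg t k) (dgE t k) hD).
Qed.

Let Rintegral_sum (f : K -> vec -> R) :
  (forall k, E.-integrable setT (EFin \o f k)) ->
  \int[E]_v (\sum_k f k v) = \sum_k \int[E]_v f k v.
Proof.
move=> intf; rewrite /Rintegral.
under eq_integral do rewrite -sumEFin.
rewrite integral_sum//= -sum_fine// => k _.
by rewrite integralE fin_numB integrable_pos_fin_num ?integrable_neg_fin_num //; exact: intf.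
Qed.

(** After integration by parts only (al - 1) times a [softmax] average of the [M t k j] is left.
    Both factors are nonpositive: the first because al <= 1, the second by [le_cov] and the signs of
    cos and sin. *)
Let dphi_ge0 t : 0 <= cos t -> 0 <= sin t -> 0 <= \int[E]_v dF t v.
Proof.
move=> ct st.
have intg k : E.-integrable setT (EFin \o (fun v => g t k v * dotv (l' t k) v)).
  apply: integrable_expbounded; first by apply: measurable_funM => //; exact: measurable_dotv.
  by apply: expbounded_mul => //; exact: expbounded_dotv.
rewrite /dF RintegralZl//; last first.
  rewrite (_ : _ \o _ = fun v => \sum_k (g t k v * dotv (l' t k) v)%:E)%E; last first.
    by apply/funext => v /=; rewrite sumEFin.
  by apply: integrable_sum => // k _; exact: intg.
rewrite mulr_ge0// Rintegral_sum// sumr_ge0// => k _; rewrite ibp.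
apply: Rintegral_ge0 => v _; rewrite /dg mulr_ge0// Mkk add0r.
rewrite mulr_le0// ?subr_le0//; apply: sumr_le0 => j _.
rewrite mulr_ge0_le0 ?softmax_ge0// ME mulr_ge0_le0 ?mulr_ge0// subr_le0.
exact: le_cov.
Qed.

(** [phi] has a nonnegative derivative on the quarter turn, and its end values are the two sides.
    Smaller covariances at equal variances thus mean a larger soft maximum. *)
Lemma slepian_lse :
  \int[E]_v expR (al * lse (fun k => dotv (a k) v)) <=
  \int[E]_v expR (al * lse (fun k => dotv (b k) v)).
Proof.
have p0 : 0 <= pi / 2 :> R by rewrite divr_ge0// pi_ge0.
have phi_le : phi 0 <= phi (pi / 2).
  apply: (@ger0_derive1_ndecr R phi 0 (pi / 2)) => //.
  - by move=> x _; have [] := dphi x.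
  - move=> x; rewrite in_itv/= => /andP[x0 x1].
    rewrite derive1E; have [_ ->] := dphi x; have := pi_ge0 R => p0'.
    by apply: dphi_ge0; [apply: cos_ge0_pihalf|apply: sin_ge0_pi]; rewrite ?in_itv/=; lra.
  - apply: continuous_subspaceT => x.
    by apply/differentiable_continuous/derivable1_diffP; have [] := dphi x.
suff E0 : phi 0 = \int[E]_v expR (al * lse (fun k => dotv (a k) v)).
  suff E1 : phi (pi / 2) = \int[E]_v expR (al * lse (fun k => dotv (b k) v)).
    by rewrite -E0 -E1.
  apply: eq_Rintegral => v _; rewrite /F; congr (expR (_ * lse _)); apply/funext => k.
  by rewrite yE cos_pihalf sin_pihalf mul0r add0r mul1r.
apply: eq_Rintegral => v _; rewrite /F; congr (expR (_ * lse _)); apply/funext => k.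
by rewrite yE cos0 sin0 mul0r addr0 mul1r.
Qed.

End slepian.

(** * Euclidean norms, nets and the spectral norm *)

Section euclidean.
Variable R : realType.

Lemma innerC M (u v : 'cV[R]_M) : inner u v = inner v u.
Proof. by apply: eq_bigr => i _; rewrite mulrC. Qed.

Lemma innerDl M (u v w : 'cV[R]_M) : inner (u + v) w = inner u w + inner v w.
Proof. by rewrite /inner -big_split; apply: eq_bigr => i _; rewrite mxE mulrDl. Qed.

Lemma innerZl M k (u v : 'cV[R]_M) : inner (k *: u) v = k * inner u v.
Proof. by rewrite /inner mulr_sumr; apply: eq_bigr => i _; rewrite mxE mulrA. Qed.

Lemma innerDr M (u v w : 'cV[R]_M) : inner w (u + v) = inner w u + inner w v.
Proof. by rewrite innerC innerDl !(innerC w). Qed.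

Lemma innerZr M k (u v : 'cV[R]_M) : inner v (k *: u) = k * inner v u.
Proof. by rewrite innerC innerZl innerC. Qed.

Lemma inner_ge0 M (u : 'cV[R]_M) : 0 <= inner u u.
Proof. by apply: sumr_ge0 => i _; rewrite -expr2 sqr_ge0. Qed.

Lemma inner_eq0 M (u : 'cV[R]_M) : inner u u = 0 -> u = 0.
Proof.
move/eqP; rewrite psumr_eq0 => [/allP u0|i _]; last by rewrite -expr2 sqr_ge0.
apply/colP => i; have := u0 i (mem_index_enum i).
by rewrite -expr2 sqrf_eq0 mxE => /eqP.
Qed.

Lemma inner_trmx M (u v : 'cV[R]_M) : u^T *m v = (inner u v)%:M.
Proof.
apply/rowP => i; rewrite !mxE ord1 eqxx mulr1n.
by apply: eq_bigr => j _; rewrite !mxE.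
Qed.

Lemma inner_mulmx M N (F : 'M[R]_(M, N)) u v : inner u (F *m v) = inner (F^T *m u) v.
Proof.
have /matrixP/(_ 0 0) : (inner u (F *m v))%:M = (inner (F^T *m u) v)%:M :> 'M[R]_1.
  by rewrite -!inner_trmx trmx_mul trmxK mulmxA.
by rewrite !mxE eqxx !mulr1n.
Qed.

Lemma enorm_ge0 M (u : 'cV[R]_M) : 0 <= enorm u.
Proof. exact: sqrtr_ge0. Qed.

Lemma sqr_enorm M (u : 'cV[R]_M) : enorm u ^+ 2 = inner u u.
Proof. by rewrite sqr_sqrtr// inner_ge0. Qed.

Lemma enorm_eq0 M (u : 'cV[R]_M) : enorm u = 0 -> u = 0.
Proof. by move=> u0; apply: inner_eq0; rewrite -sqr_enorm u0 expr0n. Qed.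

Lemma enormZ M k (u : 'cV[R]_M) : enorm (k *: u) = `|k| * enorm u.
Proof. by rewrite /enorm innerZl innerZr mulrA -expr2 sqrtrM ?sqr_ge0// sqrtr_sqr. Qed.

Lemma enorm0 M : enorm (0 : 'cV[R]_M) = 0.
Proof. by rewrite -(scale0r 0) enormZ normr0 mul0r. Qed.

Lemma inner_le1 M (u v : 'cV[R]_M) : enorm u = 1 -> enorm v = 1 -> inner u v <= 1.
Proof.
move=> u1 v1; have := inner_ge0 (u - v).
rewrite -scaleN1r innerDl !innerDr !innerZl !innerZr -!sqr_enorm u1 v1 (innerC v u).
lra.
Qed.

Lemma enorm_unit M (u : 'cV[R]_M) : enorm u != 0 -> enorm ((enorm u)^-1 *: u) = 1.
Proof. by move=> u0; rewrite enormZ ger0_norm ?invr_ge0 ?enorm_ge0// mulVf. Qed.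

Lemma ler_inner M (u v : 'cV[R]_M) : inner u v <= enorm u * enorm v.
Proof.
have [/enorm_eq0->|u0] := eqVneq (enorm u) 0.
  by rewrite -(scale0r 0) innerZl mul0r mulr_ge0 ?enorm_ge0.
have [/enorm_eq0->|v0] := eqVneq (enorm v) 0.
  by rewrite -(scale0r 0) innerZr mul0r mulr_ge0 ?enorm_ge0.
have := inner_le1 (enorm_unit u0) (enorm_unit v0).
rewrite innerZl innerZr mulrA -invfM mulrC ler_pdivrMr ?mul1r//.
by rewrite mulr_gt0// lt_neqAle eq_sym ?u0 ?v0 enorm_ge0.
Qed.

Lemma continuous_sum (T : topologicalType) n (f : 'I_n -> T -> R) :
  (forall i, continuous (f i)) -> continuous (fun x => \sum_(i < n) f i x).
Proof.
move=> cf; rewrite (_ : (fun x => _) = \sum_(i < n) f i); last first.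
  by apply/funext => x; rewrite fct_sumE.
elim/big_ind : _ => [x|g h cg ch x|i _]; [exact: cvg_cst| |exact: cf].
exact: (continuousD (cg x) (ch x)).
Qed.

Lemma continuous_inner (T : topologicalType) n (f g : T -> 'cV[R]_n) :
  (forall i, continuous (fun x => f x i 0)) -> (forall i, continuous (fun x => g x i 0)) ->
  continuous (fun x => inner (f x) (g x)).
Proof. by move=> cf cg; apply: continuous_sum => i x; exact: (continuousM (cf i x) (cg i x)). Qed.

Definition sphere n : set 'rV[R]_n := [set x | inner x^T x^T = 1].

Lemma continuous_trmx n i : continuous (fun x : 'rV[R]_n => x^T i 0).
Proof.
rewrite (_ : (fun x => _) = fun x : 'rV[R]_n => x 0 i); first exact: coord_continuous.
by apply/funext => x; rewrite mxE.
Qed.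

Lemma continuous_sqdist n (c : 'rV[R]_n) :
  continuous (fun x : 'rV[R]_n => inner (x - c)^T (x - c)^T).
Proof.
have h i : continuous (fun x : 'rV[R]_n => (x - c)^T i 0).
  rewrite (_ : (fun x => _) = fun x : 'rV[R]_n => x 0 i - c 0 i).
    by move=> x; apply: continuousB; [apply: coord_continuous|apply: cst_continuous].
  by apply/funext => x; rewrite !mxE.
exact: continuous_inner.
Qed.

Lemma sphere_compact n : compact (@sphere n).
Proof.
apply: bounded_closed_compact; last first.
  rewrite (_ : @sphere n = (fun x : 'rV[R]_n => inner x^T x^T) @^-1` [set 1])//.
  apply: preimage_closed; last exact: closed_eq.
  by move=> x _; apply: continuous_inner => i; exact: continuous_trmx.
exists 1; split => // r r1 x x1; rewrite /sphere /= in x1.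
rewrite /Num.norm/= mx_normrE; apply/bigmax_leP; split => [|[i j] _ /=].
  by rewrite (le_trans _ (ltW r1)).
rewrite (le_trans _ (ltW r1))// ord1 -[leRHS]normr1 -ler_sqr// ?nnegrE//.
rewrite !real_normK ?num_real// expr1n -x1 /inner (bigD1 j)//= !mxE expr2 lerDl.
by apply: sumr_ge0 => k _; rewrite -expr2 sqr_ge0.
Qed.

(** A finite subcover of the compact sphere. Nothing is said about its size, since the parameter
    [al] of the soft maximum is chosen after the net. *)
Lemma sphere_net n (delta : R) : 0 < delta ->
  exists (K : finType) (u : K -> 'cV[R]_n), (forall k, enorm (u k) = 1) /\
    (forall x : 'cV[R]_n, enorm x = 1 -> exists k, enorm (x - u k) <= delta).
Proof.
move=> d0.
pose U (c : 'rV[R]_n) : set 'rV[R]_n :=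
  (fun x => inner (x - c)^T (x - c)^T) @^-1` [set r | r < delta ^+ 2].
have := @sphere_compact n; rewrite compact_cover => /(_ _ (@sphere n) U) [].
- move=> c _; apply: open_comp; last exact: open_lt.
  by move=> x _; exact: continuous_sqdist.
- move=> x Sx; exists x => //; rewrite /U /= subrr linear0 /inner big1 ?exprn_gt0//.
  by move=> i _; rewrite mxE mul0r.
move=> D DS Dcov; exists D, (fun k => (val k)^T); split.
  by move=> k; have := set_mem (DS _ (valP k)); rewrite /sphere /= /enorm => ->; rewrite sqrtr1.
move=> x x1; have : @sphere n x^T.
  by rewrite /sphere /= trmxK -sqr_enorm x1 expr1n.
move=> /Dcov [c /= cD]; rewrite /U /= (_ : (x^T - c)^T = x - c^T); last by rewrite linearB /= trmxK.
move=> xc.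
exists [` cD]%fset; rewrite /enorm -[leRHS](ger0_norm (ltW d0)) -sqrtr_sqr ler_sqrt ?sqr_ge0//.
exact: ltW.
Qed.

(* The maximum of the Rayleigh quotient is an eigenvalue: the form
   [B^2 |x|^2 - |F x|^2] is nonnegative, hence its kernel contains every
   vector at which it vanishes. *)
Lemma opnorm_attained M N (F : 'M[R]_(M, N)) : (0 < N)%N ->
  exists B x0, [/\ 0 <= B, enorm x0 = 1, enorm (F *m x0) = B,
    (forall x, enorm (F *m x) <= B * enorm x) & F^T *m F *m x0 = B ^+ 2 *: x0].
Proof.
move=> N0.
have S0 : @sphere N !=set0.
  exists (delta_mx 0 (Ordinal N0)); rewrite /sphere /= /inner.
  rewrite (bigD1 (Ordinal N0))//= !mxE !eqxx mulr1 big1 ?addr0// => i i0.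
  by rewrite !mxE eqxx (negbTE i0) mul0r.
have cF : continuous (fun x : 'rV[R]_N => inner (F *m x^T) (F *m x^T)).
  have h i : continuous (fun x : 'rV[R]_N => (F *m x^T) i 0).
    rewrite (_ : (fun x => _) = fun x : 'rV[R]_N => \sum_(j < N) F i j * x 0 j).
      apply: continuous_sum => j x.
      by apply: continuousM; [apply: cst_continuous|apply: coord_continuous].
    by apply/funext => x; rewrite mxE; apply: eq_bigr => j _; rewrite mxE.
  exact: continuous_inner.
have [c /set_mem c1 cmax] := compact_EVT_max S0 (@sphere_compact N) (continuous_subspaceT cF).
pose x0 := c^T; pose B := enorm (F *m x0).
have x01 : enorm x0 = 1 by rewrite /enorm c1 sqrtr1.
have FB x : enorm (F *m x) <= B * enorm x.
  have [/enorm_eq0->|x1] := eqVneq (enorm x) 0.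
    by rewrite mulmx0 !enorm0 mulr0.
  have xx : x = enorm x *: ((enorm x)^-1 *: x) by rewrite scalerA mulfV// scale1r.
  rewrite {1}xx -scalemxAr enormZ ger0_norm ?enorm_ge0// mulrC ler_wpM2r ?enorm_ge0//.
  set z := _ *: x; have z1 : enorm z = 1 by exact: enorm_unit.
  have zS : z^T \in @sphere N by apply: mem_set; rewrite /sphere /= trmxK -sqr_enorm z1 expr1n.
  have := cmax _ zS; rewrite trmxK => h.
  by rewrite /B /enorm ler_sqrt ?inner_ge0.
exists B, x0; split => //; first exact: enorm_ge0.
have pos t w : 0 <= B ^+ 2 * inner (x0 + t *: w) (x0 + t *: w) -
    inner (F *m (x0 + t *: w)) (F *m (x0 + t *: w)).
  rewrite subr_ge0 -!sqr_enorm -exprMn ler_sqr ?nnegrE ?mulr_ge0 ?enorm_ge0//.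
have [w wE] : exists w, w = B ^+ 2 *: x0 - F^T *m F *m x0 by eexists.
suff w0 : inner w w = 0.
  by move/inner_eq0/eqP: w0; rewrite wE subr_eq0 => /eqP.
(* As a polynomial in [t], the form of [pos] has no constant term, because |F x0| = B |x0|, and its
   linear coefficient is 2 |w|^2 by the choice of [w]. *)
have key t : 0 <= 2 * t * inner w w + t ^+ 2 * (B ^+ 2 * inner w w - inner (F *m w) (F *m w)).
  apply: le_trans (pos t w) _; rewrite le_eqVlt; apply/orP; left; apply/eqP.
  rewrite mulmxDr -scalemxAr !innerDl !innerDr !innerZl !innerZr.
  rewrite (innerC w x0) (innerC (F *m w)) -!(sqr_enorm x0) x01 -(sqr_enorm (F *m x0)) -/B.
  have -> : inner (F *m x0) (F *m w) = inner (F^T *m F *m x0) w.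
    by rewrite inner_mulmx mulmxA.
  have -> : inner w w = B ^+ 2 * inner x0 w - inner (F^T *m F *m x0) w.
    by rewrite {1}wE innerDl innerZl -scaleN1r innerZl mulN1r.
  ring.
set p := inner w w in key *; set q := B ^+ 2 * p - _ in key.
have p0 : 0 <= p by exact: inner_ge0.
apply/eqP; rewrite eq_le p0 andbT leNgt; apply/negP => pgt.
(* A positive linear coefficient would make the polynomial negative at -1 if [q <= 0], and at its
   minimum [- (p / q)] otherwise. *)
have [q0|q0] := leP q 0; first by have := key (-1); lra.
have := key (- (p / q)); rewrite sqrrN expr2 -!mulrA mulVf ?gt_eqF// mulr1 => h.
have : p / q * p <= 0 by move: h; rewrite !mulNr !mulrN; lra.
by apply/negP; rewrite -ltNge !mulr_gt0// invr_gt0.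
Qed.

End euclidean.

Section spectral_norm.
Variables (R : realType) (M N : nat).
Hypothesis N0 : (0 < N)%N.
Implicit Types F : 'M[R]_(M, N).

Lemma singular_value_le F c : (forall x, enorm (F *m x) <= c * enorm x) -> 0 <= c ->
  forall s, singular_values F s -> s <= c.
Proof.
move=> Fc c0 s [a /= /eigenvalueP [v vF v0] <-].
have va : inner (F *m v^T) (F *m v^T) = a * inner v^T v^T.
  have e : F^T *m F *m v^T = a *: v^T.
    have eF : (F^T *m F)^T = F^T *m F by rewrite trmx_mul trmxK.
    by rewrite -[LHS]trmxK trmx_mul (trmxK v) eF vF linearZ.
  by rewrite inner_mulmx mulmxA e innerZl.
have vn : 0 < inner v^T v^T.
  rewrite lt_neqAle inner_ge0 andbT eq_sym; apply/eqP => /inner_eq0 h.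
  by move/eqP: v0; apply; rewrite -[v]trmxK h linear0.
rewrite -[leRHS](ger0_norm c0) -sqrtr_sqr ler_sqrt ?sqr_ge0//.
rewrite -(ler_pM2r vn) -va -!sqr_enorm -exprMn ler_sqr ?nnegrE ?enorm_ge0//.
by rewrite mulr_ge0 ?enorm_ge0.
Qed.

(** The supremum of the singular values is reached at the norming vector of [opnorm_attained], so it
    is the operator norm. [eigenvalue] acts on row vectors, whence the transpositions. *)
Lemma spectral_norm_leP F c : 0 <= c ->
  spectral_norm F <= c <-> (forall x, enorm (F *m x) <= c * enorm x).
Proof.
move=> c0; have [B [x0 [B0 x01 Fx0 FB eig]]] := opnorm_attained F N0.
have BS : singular_values F B.
  exists (B ^+ 2); last by rewrite sqrtr_sqr ger0_norm.
  apply/eigenvalueP; exists x0^T.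
    have eF : (F^T *m F)^T = F^T *m F by rewrite trmx_mul trmxK.
    by rewrite -eF -trmx_mul eig linearZ.
  by apply/eqP => h; move: x01; rewrite -[x0]trmxK h linear0 enorm0 => /eqP; rewrite eq_sym oner_eq0.
have SB := singular_value_le FB B0.
have -> : spectral_norm F = B.
  apply/eqP; rewrite eq_le; apply/andP; split.
    by apply: sup_le_ub; [exists B|exact: SB].
  by apply: ub_le_sup => //; exists B; exact: SB.
split=> [Bc x|Fc]; first by rewrite (le_trans (FB x))// ler_wpM2r ?enorm_ge0.
by rewrite -Fx0 (le_trans (Fc x0))// x01 mulr1.
Qed.

(** Take a norming vector x0 and y0 = F x0 / B. Moving each to its net changes <y0, F x0> = B by at
    most delta * B, so B <= s + 2 delta B. *)
Lemma opnorm_le_net F (delta s : R) (K L : Type) (u : K -> 'cV[R]_N) (w : L -> 'cV[R]_M) :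
  (forall x : 'cV[R]_N, enorm x = 1 -> exists k, enorm (x - u k) <= delta) ->
  (forall x : 'cV[R]_M, enorm x = 1 -> exists k, enorm (x - w k) <= delta) ->
  (forall l, enorm (w l) = 1) ->
  delta < 2^-1 -> 0 <= s -> (forall k l, inner (w l) (F *m u k) <= s) ->
  forall x, enorm (F *m x) <= s / (1 - 2 * delta) * enorm x.
Proof.
move=> netu netw w1 d2 s0 Fs x.
have [B [x0 [B0 x01 Fx0 FB _]]] := opnorm_attained F N0.
rewrite (le_trans (FB x))// ler_wpM2r ?enorm_ge0//.
have d1 : 0 < 1 - 2 * delta by lra.
have [->|Bn0] := eqVneq B 0; first by rewrite divr_ge0// ltW.
rewrite ler_pdivlMr//.
pose y0 := B^-1 *: (F *m x0).
have y01 : enorm y0 = 1 by rewrite /y0 -Fx0 enorm_unit// Fx0.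
have [k uk] := netu _ x01; have [l wl] := netw _ y01.
have : B = inner y0 (F *m x0) by rewrite innerZl -sqr_enorm Fx0 expr2 mulrA mulVf// mul1r.
have -> : inner y0 (F *m x0) =
    inner (w l) (F *m u k) + inner (w l) (F *m (x0 - u k)) + inner (y0 - w l) (F *m x0).
  rewrite -innerDr -mulmxDr addrCA subrr addr0 -innerDl; congr inner.
  by rewrite addrCA subrr addr0.
have := ler_inner (w l) (F *m (x0 - u k)).
have := ler_inner (y0 - w l) (F *m x0).
rewrite w1 mul1r Fx0 => h1 h2 h3.
have h4 : enorm (y0 - w l) * B <= delta * B by rewrite ler_wpM2r.
have h5 : enorm (F *m (x0 - u k)) <= B * delta.
  by rewrite (le_trans (FB _))// ler_wpM2l.
have := Fs k l; rewrite mulrBr mulr1; lra.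
Qed.

End spectral_norm.

(** * Scalar inequalities for the Laplace transform of the chi-square law *)

Section gaussian_norms.
Variable R : realType.

(** As exp w >= 1 + w, it is enough that (1 + w)^2 (1 - x) >= 1, which reduces to 3 x + x^2 + x^3 <=
    1; [5 * x <= 1] leaves room for this. It is the origin of every factor 5 below. *)
Lemma inv_sqrt1B_le (x : R) : 0 <= x -> 5 * x <= 1 ->
  (Num.sqrt (1 - x))^-1 <= expR (x / 2 + x ^+ 2 / 2).
Proof.
move=> x0 x1; set w := x / 2 + _.
have w0 : 0 <= w by rewrite addr_ge0// divr_ge0// sqr_ge0.
have s0 : 0 < Num.sqrt (1 - x) by rewrite sqrtr_gt0; lra.
rewrite -div1r ler_pdivrMr//.
have w1 : 1 <= (1 + w) ^+ 2 * (1 - x).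
  have -> : (1 + w) ^+ 2 * (1 - x) = 1 + x ^+ 2 / 4 * (1 - 3 * x - x ^+ 2 - x ^+ 3).
    by rewrite /w; field.
  rewrite lerDl mulr_ge0 ?divr_ge0 ?sqr_ge0//.
  have x2 : x ^+ 2 <= x / 5 by rewrite expr2; nra.
  have x3 : x ^+ 3 <= x / 5 by rewrite exprS; nra.
  lra.
rewrite -ler_sqr ?nnegrE ?mulr_ge0 ?expR_ge0 ?sqrtr_ge0// expr1n exprMn sqr_sqrtr; last by lra.
rewrite (le_trans w1)// ler_wpM2r//; first by lra.
by rewrite ler_sqr ?nnegrE ?expR_ge0 ?expR_ge1Dx// addr_ge0.
Qed.

(** The difference of the two sides vanishes at 0 and has derivative t^2 / (1 + t). *)
Lemma ln1D_ge (y : R) : 0 <= y -> y - y ^+ 2 / 2 <= ln (1 + y).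
Proof.
move=> y0; pose f (t : R) := ln (1 + t) - (t - t ^+ 2 / 2).
have df (t : R) : 0 <= t -> is_derive t 1 f (t ^+ 2 / (1 + t)).
  move=> t0; have t1 : 0 < 1 + t by lra.
  have h1 : is_derive t 1 (fun x : R => 1 + x) 1.
    by apply: is_derive_eq; rewrite add0r mulr1.
  have h2 := @is_derive1_comp R (@ln R) (fun x => 1 + x) t _ _ (is_derive1_ln t1) h1.
  have h3 : is_derive t 1 (fun x : R => x - x ^+ 2 / 2) (1 - t).
    by apply: is_derive_eq; rewrite /GRing.scale/=; field.
  rewrite (_ : t ^+ 2 / (1 + t) = (1 + t)^-1 * 1 - (1 - t)); last by field; rewrite gt_eqF.
  exact: is_deriveB h2 h3.
have : f 0 <= f y.
  apply: (@ger0_derive1_ndecr R f 0 y) => //.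
  - by move=> x; rewrite in_itv/= => /andP[x0 _]; have [] := df x (ltW x0).
  - move=> x; rewrite in_itv/= => /andP[x0 _]; rewrite derive1E.
    have [_ ->] := df x (ltW x0); rewrite divr_ge0 ?sqr_ge0//; lra.
  - apply: derivable_within_continuous => x; rewrite in_itv/= => /andP[x0 _].
    by have [] := df x x0.
by rewrite /f addr0 ln1 expr0n/= mul0r subr0 subrr subr_ge0.
Qed.

End gaussian_norms.

(** * Norms of Gaussian vectors *)

Section gaussian_block_norms.
Variables (R : realType) (I : finType).
Local Notation vec := (#|I|.-tuple R).
Local Notation E := (@gaussv R I).

Definition bnorm (S : pred I) (v : vec) : R := Num.sqrt (\sum_(i | S i) crd i v ^+ 2).

Lemma measurable_sumsq (S : pred I) : measurable_fun setT (fun v : vec => \sum_(i | S i) crd i v ^+ 2).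
Proof.
rewrite (_ : (fun v => _) = (fun v => \sum_i (if S i then crd i v ^+ 2 else 0))); last first.
  by apply/funext => v; rewrite big_mkcond.
apply: measurable_sum => i; case: (S i) => //.
exact: (measurable_funX 2 (measurable_crd i)).
Qed.

Lemma measurable_bnorm (S : pred I) : measurable_fun setT (bnorm S).
Proof.
apply: (measurableT_comp _ (measurable_sumsq S)).
exact: (continuous_measurable_fun (@sqrt_continuous R)).
Qed.

Lemma gaussv_expR_sumsq (x : I -> R) : (forall i, x i < 1) ->
  (\int[E]_v (expR (\sum_i x i * crd i v ^+ 2 / 2))%:E =
   (\prod_i (Num.sqrt (1 - x i))^-1)%:E)%E.
Proof.
move=> x1; under eq_integral do rewrite expR_sum.
rewrite (@ge0_integral_gaussv_prod R I (fun i z => expR (x i * z ^+ 2 / 2))); last 2 first.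
- move=> i; apply: measurableT_comp => //; apply: measurable_funM => //.
  by apply: measurable_funM => //; exact: measurable_funX.
- by move=> i z; exact: expR_ge0.
rewrite -prodEFin; apply: eq_bigr => i _; exact: gauss_expR_sqr.
Qed.

(** The square root is concave, hence below its tangent at [n], the mean of a chi-square variable
    with [n] degrees of freedom. This trades norms for their squares, whose Laplace transform is
    explicit. *)
Lemma expR_norm_le (l s : R) n : 0 <= l -> 0 <= s -> (0 < n)%N ->
  l * Num.sqrt s <= l * Num.sqrt n%:R / 2 + l / Num.sqrt n%:R * s / 2.
Proof.
move=> l0 s0 n0; have n1 : 0 < Num.sqrt (n%:R : R) by rewrite sqrtr_gt0 ltr0n.
have := sqr_ge0 (Num.sqrt s - Num.sqrt n%:R).
rewrite -[X in l / _ * X / 2]sqr_sqrtr//.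
set a := Num.sqrt s; set b := Num.sqrt n%:R => h.
have -> : l * b / 2 + l / b * a ^+ 2 / 2 = l * a + l / b * (a - b) ^+ 2 / 2.
  by field; rewrite gt_eqF.
by rewrite lerDl divr_ge0// mulr_ge0// divr_ge0// ltW.
Qed.

(** Once both norms are linearised by [expR_norm_le], the coordinates of block [k] carry the weight
    l / r_k. By [inv_sqrt1B_le] a block then contributes l r_k / 2 + l^2 / 2 on top of the l r_k / 2
    of the linearisation. *)
Lemma gaussv_expR_bnorm2 (S1 S2 : {set I}) (l : R) :
  (0 < #|S1|)%N -> (0 < #|S2|)%N -> (forall i, i \in S1 -> i \notin S2) -> 0 <= l ->
  5 * l <= Num.sqrt #|S1|%:R -> 5 * l <= Num.sqrt #|S2|%:R ->
  (\int[E]_v (expR (l * (bnorm (mem S1) v + bnorm (mem S2) v)))%:E <=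
   (expR (l * (Num.sqrt #|S1|%:R + Num.sqrt #|S2|%:R) + l ^+ 2))%:E)%E.
Proof.
move=> n1 n2 S12 l0 l1 l2.
set r1 := Num.sqrt #|S1|%:R in l1 *; set r2 := Num.sqrt #|S2|%:R in l2 *.
have r10 : 0 < r1 by rewrite sqrtr_gt0 ltr0n.
have r20 : 0 < r2 by rewrite sqrtr_gt0 ltr0n.
pose x i := if i \in S1 then l / r1 else if i \in S2 then l / r2 else 0.
have lr1 : 0 <= l / r1 <= 5^-1.
  by rewrite divr_ge0//=; [rewrite ler_pdivrMr//; lra|exact: ltW].
have lr2 : 0 <= l / r2 <= 5^-1.
  by rewrite divr_ge0//=; [rewrite ler_pdivrMr//; lra|exact: ltW].
have xb i : 0 <= x i <= 5^-1 by rewrite /x; do 2 case: ifP => // _; lra.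
have sumx (f : R -> R) : f 0 = 0 ->
    \sum_i f (x i) = f (l / r1) *+ #|S1| + f (l / r2) *+ #|S2|.
  move=> f0; rewrite (bigID (mem S1))/= (eq_bigr (fun=> f (l / r1))); last first.
    by move=> i iS; rewrite /x iS.
  rewrite sumr_const; congr (_ + _).
  rewrite (bigID (mem S2))/= (eq_bigl (fun i => i \in S2)); last first.
    move=> i; rewrite andb_idl// => iS2.
    by apply/negP => /S12; rewrite iS2.
  rewrite (eq_bigr (fun=> f (l / r2))); last first.
    move=> i iS; rewrite /x iS; case: ifP => // /S12; by rewrite iS.
  rewrite sumr_const big1 ?addr0// => i /andP[/negbTE i1 /negbTE i2].
  by rewrite /x i1 i2.
apply: (@le_trans _ _ (\int[E]_v ((expR (l * r1 / 2 + l * r2 / 2))%:E *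
    (expR (\sum_i x i * crd i v ^+ 2 / 2))%:E))%E).
  apply: ge0_le_integral => //.
  - apply/measurable_EFinP; apply: measurableT_comp => //; apply: measurable_funM => //.
    by apply: measurable_funD; exact: measurable_bnorm.
  - apply: emeasurable_funM => //; apply/measurable_EFinP; apply: measurableT_comp => //.
    apply: measurable_sum => i; apply: measurable_funM => //; apply: measurable_funM => //.
    exact: (measurable_funX 2 (measurable_crd i)).
  - move=> v _; rewrite -EFinM lee_fin -expRD ler_expR.
    have h (S : {set I}) : (0 < #|S|)%N -> l * bnorm (mem S) v <=
        l * Num.sqrt #|S|%:R / 2 + l / Num.sqrt #|S|%:R * (\sum_(i in S) crd i v ^+ 2) / 2.
      by move=> S0; apply: expR_norm_le => //; apply: sumr_ge0 => i _; exact: sqr_ge0.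
    have := h S1 n1; have := h S2 n2; rewrite -/r1 -/r2 mulrDr => h2 h1.
    have -> : \sum_i x i * crd i v ^+ 2 / 2 = l / r1 * (\sum_(i in S1) crd i v ^+ 2) / 2 +
        l / r2 * (\sum_(i in S2) crd i v ^+ 2) / 2.
      rewrite (bigID (mem S1))/= mulr_sumr mulr_suml; congr (_ + _).
        by apply: eq_bigr => i iS; rewrite /x iS.
      rewrite (bigID (mem S2))/= [X in _ + X]big1 ?addr0; last first.
        by move=> i /andP[/negbTE i1 /negbTE i2]; rewrite /x i1 i2 !mul0r.
      rewrite mulr_sumr mulr_suml; apply: eq_big => i.
        rewrite andb_idl// => iS2.
        by apply/negP => /S12; rewrite iS2.
      by move=> /andP[/negbTE i1 i2]; rewrite /x i1 i2.
    lra.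
rewrite ge0_integralZl//; last first.
  apply/measurable_EFinP; apply: measurableT_comp => //.
  apply: measurable_sum => i; apply: measurable_funM => //; apply: measurable_funM => //.
  exact: (measurable_funX 2 (measurable_crd i)).
rewrite gaussv_expR_sumsq; last by move=> i; have := xb i; lra.
rewrite -EFinM lee_fin.
apply: (@le_trans _ _ (expR (l * r1 / 2 + l * r2 / 2) *
    \prod_i expR (x i / 2 + x i ^+ 2 / 2))).
  rewrite ler_wpM2l ?expR_ge0//; apply: ler_prod => i _.
  rewrite invr_ge0 sqrtr_ge0/= inv_sqrt1B_le//; first by case/andP: (xb i).
  by have := xb i; lra.
rewrite -expR_sum -expRD ler_expR (sumx (fun z => z / 2 + z ^+ 2 / 2)); last first.
  by rewrite expr0n/= !mul0r addr0.
have r1E : #|S1|%:R = r1 ^+ 2 by rewrite sqr_sqrtr.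
have r2E : #|S2|%:R = r2 ^+ 2 by rewrite sqr_sqrtr.
rewrite -(mulr_natr _ #|S1|) -(mulr_natr _ #|S2|) r1E r2E.
rewrite le_eqVlt; apply/orP; left; apply/eqP; field.
by rewrite !gt_eqF.
Qed.

End gaussian_block_norms.

(** * The largest singular value of a Gaussian matrix *)

Section chevet.
Variables (R : realType) (M N : nat) (L K : finType).
Variables (w : L -> 'cV[R]_M) (u : K -> 'cV[R]_N).
Hypotheses (w1 : forall l, enorm (w l) = 1) (u1 : forall k, enorm (u k) = 1).
Hypotheses (LK0 : (0 < #|{: L * K}|)%N) (M0 : (0 < M)%N) (N0 : (0 < N)%N).

Let J : finType := ('I_M * 'I_N)%type.
Let C : finType := ('I_N + 'I_M + unit)%type.
Let I : finType := (J + C)%type.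

Definition bilinear_coef (p : L * K) (q : J) : R := w p.1 q.1 0 * u p.2 q.2 0.

(* The Gaussian processes compared are [<w, G u> + xi] and [<g, u> + <h, w>];
   the extra variable [xi] makes their variances equal. *)
Let a (be : R) (p : L * K) (i : I) : R :=
  match i with
  | inl q => be * bilinear_coef p q
  | inr (inl _) => 0
  | inr (inr _) => be
  end.

Let b (be : R) (p : L * K) (i : I) : R :=
  match i with
  | inl _ => 0
  | inr (inl (inl n)) => be * u p.2 n 0
  | inr (inl (inr m)) => be * w p.1 m 0
  | inr (inr _) => 0
  end.

Let big_I (f : I -> R) : \sum_i f i = \sum_(q : J) f (inl q) +
  (\sum_(n < N) f (inr (inl (inl n))) + \sum_(m < M) f (inr (inl (inr m))) + f (inr (inr tt))).
Proof.
rewrite big_sumType; congr (_ + _); rewrite big_sumType big_sumType; congr (_ + _).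
by rewrite (bigD1 tt)//= big1 ?addr0// => -[].
Qed.

Let bilinear_cov p p' : \sum_q bilinear_coef p q * bilinear_coef p' q =
  inner (w p.1) (w p'.1) * inner (u p.2) (u p'.2).
Proof.
rewrite /inner big_distrlr /= pair_bigA /=; apply: eq_bigr => q _.
by rewrite /bilinear_coef; ring.
Qed.

Let cov_a be p p' : \sum_i a be p i * a be p' i =
  be ^+ 2 * (inner (w p.1) (w p'.1) * inner (u p.2) (u p'.2) + 1).
Proof.
rewrite big_I /= [X in _ + (X + _ + _)]big1 => [|n _]; last by rewrite mul0r.
rewrite [X in _ + (_ + X + _)]big1 => [|m _]; last by rewrite mul0r.
rewrite !add0r mulrDr mulr1 -expr2; congr (_ + _); rewrite -bilinear_cov mulr_sumr.
by apply: eq_bigr => q _; ring.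
Qed.

Let cov_b be p p' : \sum_i b be p i * b be p' i =
  be ^+ 2 * (inner (w p.1) (w p'.1) + inner (u p.2) (u p'.2)).
Proof.
rewrite big_I /= big1 ?add0r; last by move=> *; rewrite mul0r.
rewrite mul0r addr0 mulrDr addrC /inner !mulr_sumr; congr (_ + _).
  by apply: eq_bigr => q _; ring.
by apply: eq_bigr => q _; ring.
Qed.

Let inner_w l : inner (w l) (w l) = 1. Proof. by rewrite -sqr_enorm w1 expr1n. Qed.
Let inner_u k : inner (u k) (u k) = 1. Proof. by rewrite -sqr_enorm u1 expr1n. Qed.

Let eq_norm be p : \sum_i a be p i ^+ 2 = \sum_i b be p i ^+ 2.
Proof.
under eq_bigr do rewrite expr2; under [RHS]eq_bigr do rewrite expr2.
by rewrite cov_a cov_b !inner_w !inner_u mulr1.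
Qed.

(** The difference is be^2 (1 - <w, w'>) (1 - <u, u'>), a product of nonnegative factors on unit
    spheres. *)
Let le_cov be p p' : \sum_i b be p i * b be p' i <= \sum_i a be p i * a be p' i.
Proof.
rewrite cov_a cov_b ler_wpM2l ?sqr_ge0//.
have := inner_le1 (w1 p.1) (w1 p'.1); have := inner_le1 (u1 p.2) (u1 p'.2).
set x := inner _ _; set y := inner _ _ => x1 y1.
by have := mulr_ge0 (_ : 0 <= 1 - x) (_ : 0 <= 1 - y); rewrite !subr_ge0 => /(_ x1 y1); lra.
Qed.

Let orth be p p' : \sum_i a be p i * b be p' i = 0.
Proof. by rewrite big1// => -[q|[[n|m]|[]]] _ /=; rewrite ?mul0r ?mulr0. Qed.

Let xi : I -> R := fun i => if i is inr (inr _) then 1 else 0.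

Let gI : {set I} := [set i | if i is inr (inl (inl _)) then true else false].
Let hI : {set I} := [set i | if i is inr (inl (inr _)) then true else false].

Let card_gI : #|gI| = N.
Proof.
rewrite -[RHS]card_ord -(card_imset _ (_ : injective (fun n : 'I_N => inr (inl (inl n)) : I))).
  apply: eq_card => i; rewrite inE; apply/idP/imsetP => [|[n _ ->]//].
  by case: i => [q|[[n|m]|[]]]// _; exists n.
by move=> n n' [].
Qed.

Let card_hI : #|hI| = M.
Proof.
rewrite -[RHS]card_ord -(card_imset _ (_ : injective (fun n : 'I_M => inr (inl (inr n)) : I))).
  apply: eq_card => i; rewrite inE; apply/idP/imsetP => [|[n _ ->]//].
  by case: i => [q|[[n|m]|[]]]// _; exists m.
by move=> n n' [].
Qed.

Let sumsq_g (v : #|I|.-tuple R) : \sum_(i in gI) crd i v ^+ 2 =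
  \sum_(n < N) crd (inr (inl (inl n)) : I) v ^+ 2.
Proof.
rewrite big_mkcond big_I /= inE addr0.
rewrite [X in X + _]big1 => [|q _]; last by rewrite inE.
rewrite [X in _ + (_ + X)]big1 => [|q _]; last by rewrite inE.
by rewrite add0r addr0; apply: eq_bigr => n _; rewrite inE.
Qed.

Let sumsq_h (v : #|I|.-tuple R) : \sum_(i in hI) crd i v ^+ 2 =
  \sum_(m < M) crd (inr (inl (inr m)) : I) v ^+ 2.
Proof.
rewrite big_mkcond big_I /= inE addr0.
rewrite [X in X + _]big1 => [|q _]; last by rewrite inE.
rewrite [X in _ + (X + _)]big1 => [|q _]; last by rewrite inE.
by rewrite !add0r; apply: eq_bigr => n _; rewrite inE.
Qed.

Let dotv_a be p v : dotv (a be p) v =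
  be * dotv (bilinear_coef p) (tup (fun q : J => crd (inl q : I) v)) + be * crd (inr (inr tt) : I) v.
Proof.
rewrite /dotv big_I /= [X in _ + (X + _ + _)]big1 => [|n _]; last by rewrite mul0r.
rewrite [X in _ + (_ + X + _)]big1 => [|m _]; last by rewrite mul0r.
by rewrite !add0r mulr_sumr; congr (_ + _); apply: eq_bigr => q _; rewrite crd_tup mulrA.
Qed.

Let dotv_b_le be p v : 0 <= be ->
  dotv (b be p) v <= be * (bnorm (mem gI) v + bnorm (mem hI) v).
Proof.
move=> be0.
pose g : 'cV[R]_N := \col_n crd (inr (inl (inl n)) : I) v.
pose h : 'cV[R]_M := \col_m crd (inr (inl (inr m)) : I) v.
have -> : dotv (b be p) v = be * (inner (u p.2) g + inner (w p.1) h).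
  rewrite /dotv big_I /= [X in X + _]big1 => [|q _]; last by rewrite mul0r.
  rewrite mul0r add0r addr0 mulrDr /inner !mulr_sumr; congr (_ + _).
    by apply: eq_bigr => n _; rewrite mxE mulrA.
  by apply: eq_bigr => n _; rewrite mxE mulrA.
rewrite ler_wpM2l// lerD//.
  rewrite (le_trans (ler_inner _ _))// u1 mul1r /bnorm sumsq_g /enorm le_eqVlt.
  by apply/orP; left; apply/eqP; congr Num.sqrt; apply: eq_bigr => n _; rewrite mxE expr2.
rewrite (le_trans (ler_inner _ _))// w1 mul1r /bnorm sumsq_h /enorm le_eqVlt.
by apply/orP; left; apply/eqP; congr Num.sqrt; apply: eq_bigr => n _; rewrite mxE expr2.
Qed.

(** Slepian's inequality passes to [b], whose soft maximum is at most ln #|L * K| plus be (|g| +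
    |h|) by Cauchy-Schwarz. The block bound leaves the term l^2 in the exponent, and removing the
    independent variable xi takes l^2 / 2 away. *)
Lemma chevet_expR (al be : R) : 0 <= al -> al <= 1 -> 0 <= be ->
  5 * (al * be) <= Num.sqrt M%:R -> 5 * (al * be) <= Num.sqrt N%:R ->
  (\int[gaussv R J]_v (expR (al * lse (fun p => be * dotv (bilinear_coef p) v)))%:E <=
   (expR (al * ln #|{: L * K}|%:R + al * be * (Num.sqrt M%:R + Num.sqrt N%:R) +
          (al * be) ^+ 2 / 2))%:E)%E.
Proof.
move=> al0 al1 be0 lM lN; set l := al * be in lM lN *.
have l0 : 0 <= l by rewrite mulr_ge0.
pose X0 (v : #|J|.-tuple R) := expR (al * lse (fun p => be * dotv (bilinear_coef p) v)).
have mX0 : measurable_fun setT X0.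
  apply: measurableT_comp => //; apply: measurable_funM => //.
  apply: measurableT_comp => //; apply: measurable_sum => p.
  by apply: measurableT_comp => //; apply: measurable_funM => //; exact: measurable_dotv.
rewrite (@ge0_integral_gaussv_inl R J C (EFin \o X0)); last 2 first.
- exact/measurable_EFinP.
- by move=> v; rewrite lee_fin expR_ge0.
pose f (v : #|I|.-tuple R) := X0 (tup (fun q : J => crd (inl q : I) v)).
have mf : measurable_fun setT f.
  by apply: (measurableT_comp mX0); apply: measurable_tup => q; exact: measurable_crd.
have lseXi v : expR (al * lse (fun p => dotv (a be p) v)) = f v * expR (l * dotv xi v).
  rewrite /f /X0 -expRD; congr expR.
  have -> : dotv xi v = crd (inr (inr tt) : I) v.
    rewrite /dotv big_I /= !big1 ?add0r ?mul1r//; by move=> *; rewrite mul0r.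
  rewrite /l -mulrA -mulrDr; congr (_ * _).
  set c := be * crd _ v.
  rewrite /lse -[X in _ + X]expRK -lnM ?posrE ?expR_gt0 ?sumexp_gt0//; congr ln.
  by rewrite /sumexp mulr_suml; apply: eq_bigr => p _; rewrite -expRD dotv_a.
have sl := @slepian_lse R I _ (a be) (b be) al LK0 al0 al1 (eq_norm be) (le_cov be) (orth be).
have intA := @integrable_expR_lse_dotv R I _ LK0 (a be) al al0.
set r := expR (_ + _ + _).
have leB : (\int[gaussv R I]_v (expR (al * lse (fun p => dotv (b be p) v)))%:E <=
    (r * expR (l ^+ 2 / 2))%:E)%E.
  have C0 : 0 <= expR (al * ln #|{: L * K}|%:R) :> R by exact: expR_ge0.
  apply: (@le_trans _ _ (\int[gaussv R I]_v ((expR (al * ln #|{: L * K}|%:R))%:E *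
      (expR (l * (bnorm (mem gI) v + bnorm (mem hI) v)))%:E))%E).
    apply: ge0_le_integral => //.
    - apply/measurable_EFinP; apply: measurableT_comp => //.
      by apply: measurable_funM => //; exact: measurable_lse_dotv.
    - apply: emeasurable_funM => //; apply/measurable_EFinP; apply: measurableT_comp => //.
      by apply: measurable_funM => //; apply: measurable_funD; exact: measurable_bnorm.
    - move=> v _; rewrite -EFinM lee_fin -expRD ler_expR /l -mulrA -mulrDr ler_wpM2l//.
      by apply: lse_le => // p; exact: dotv_b_le.
  rewrite ge0_integralZl//; last first.
    apply/measurable_EFinP; apply: measurableT_comp => //.
    by apply: measurable_funM => //; apply: measurable_funD; exact: measurable_bnorm.
  apply: (@le_trans _ _ ((expR (al * ln #|{: L * K}|%:R))%:E *
      (expR (l * (Num.sqrt N%:R + Num.sqrt M%:R) + l ^+ 2))%:E)%E).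
    apply: lee_wpmul2l; first by rewrite lee_fin.
    have := @gaussv_expR_bnorm2 R I gI hI l; rewrite card_gI card_hI; apply => //.
    by case=> [q|[[n|m]|[]]]; rewrite !inE.
  rewrite -EFinM lee_fin -!expRD ler_expR le_eqVlt; apply/orP; left; apply/eqP.
  by rewrite /l; field.
have leA : (\int[gaussv R I]_v (expR (al * lse (fun p => dotv (a be p) v)))%:E <=
    (r * expR (l ^+ 2 / 2))%:E)%E.
  have fA : (\int[gaussv R I]_v (expR (al * lse (fun p => dotv (a be p) v)))%:E)%E \is a fin_num.
    exact: integrable_fin_num.
  have fB : (\int[gaussv R I]_v (expR (al * lse (fun p => dotv (b be p) v)))%:E)%E \is a fin_num.
    rewrite ge0_fin_numE; first by rewrite (le_lt_trans leB)// ltry.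
    by apply: integral_ge0 => v _; rewrite lee_fin expR_ge0.
  rewrite -(fineK fA) lee_fin; apply: (le_trans sl).
  by move: leB; rewrite -(fineK fB) lee_fin.
pose c i := l * xi i.
have mfE : measurable_fun setT (EFin \o f) by exact/measurable_EFinP.
have f0 v : (0 <= (EFin \o f) v)%E by rewrite lee_fin expR_ge0.
have sumc v : \sum_i (c i * crd i v - c i ^+ 2 / 2) = l * dotv xi v - l ^+ 2 / 2.
  rewrite big_split/= sumrN /dotv mulr_sumr; congr (_ - _).
    by apply: eq_bigr => i _; rewrite /c mulrA.
  rewrite -mulr_suml big_I /c /= !big1; try by move=> *; rewrite mulr0 expr0n.
  by rewrite !add0r mulr1.
(* [f] does not see the coordinate xi, so a Cameron-Martin shift along it fixes [f]; this factors E
   exp (l xi) = exp (l^2 / 2) out without invoking independence. *)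
have shift : (\int[gaussv R I]_v (f v)%:E * (expR (l ^+ 2 / 2))%:E =
    \int[gaussv R I]_v (expR (al * lse (fun p => dotv (a be p) v)))%:E)%E.
  have h : (\int[gaussv R I]_v (f v)%:E =
      \int[gaussv R I]_v ((EFin \o f) v * (expR (\sum_i (c i * crd i v - c i ^+ 2 / 2)))%:E))%E.
    rewrite -(gaussv_shift c mfE f0); apply: eq_integral => v _ /=.
    rewrite /f; congr (X0 _)%:E; congr tup; apply/funext => q.
    by rewrite crd_tup /c mulr0 addr0.
  rewrite h -ge0_integralZr//.
  - apply: eq_integral => v _; rewrite /= -!EFinM lseXi sumc -mulrA -expRD.
    by congr (_ * expR _)%:E; rewrite subrK.
  - apply: emeasurable_funM => //; apply/measurable_EFinP; apply: measurableT_comp => //.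
    under eq_fun do rewrite sumc.
    by apply: measurable_funB => //; apply: measurable_funM => //; exact: measurable_dotv.
  - by move=> v _; rewrite mule_ge0// lee_fin expR_ge0.
have e0 : (0 < (expR (l ^+ 2 / 2))%:E :> \bar R)%E by rewrite lte_fin expR_gt0.
by rewrite -(lee_pmul2r _ e0)// shift -EFinM.
Qed.

End chevet.

Lemma measure_le_expectation (R : realType) d (T : measurableType d)
    (P : {measure set T -> \bar R}) (D : set T) (f : T -> R) (c r : R) :
  measurable D -> measurable_fun setT f -> (forall t, 0 <= f t) -> 0 < c ->
  (forall t, D t -> c <= f t) -> (\int[P]_t (f t)%:E <= r%:E)%E ->
  (P D <= (r / c)%:E)%E.
Proof.
move=> mD mf f0 c0 Df fr.
have cD : (\int[P]_t (c * \1_D t)%:E = c%:E * P D)%E.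
  under eq_integral do rewrite EFinM.
  rewrite ge0_integralZl//; first by rewrite integral_indic// setIT.
  - exact/measurable_EFinP/measurable_indic.
  - exact: ltW.
rewrite EFinM lee_pdivlMr// muleC -cD; apply: le_trans fr.
apply: ge0_le_integral => //.
- by move=> t _; rewrite lee_fin mulr_ge0// ltW.
- by apply/measurable_EFinP; apply: measurable_funM => //; exact: measurable_indic.
- exact/measurable_EFinP.
- move=> t _; rewrite lee_fin indicE; case: (boolP (t \in D)) => [/set_mem/Df|_].
    by rewrite mulr1.
  by rewrite mulr0.
Qed.

Section gaussian_matrix.
Variables (R : realType) (M N : nat).
Local Notation J := ('I_M * 'I_N)%type.
Local Notation vec := (#|{: J}|.-tuple R).

Definition mx_of (v : vec) : 'M[R]_(M, N) := \matrix_(m, n) crd (m, n) v.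

Lemma inner_mx_of (w : 'cV[R]_M) (u : 'cV[R]_N) v :
  inner w (mx_of v *m u) = dotv (fun q : J => w q.1 0 * u q.2 0) v.
Proof.
transitivity (\sum_(m < M) \sum_(n < N) w m 0 * u n 0 * crd ((m, n) : J) v).
  apply: eq_bigr => m _; rewrite mxE mulr_sumr; apply: eq_bigr => n _.
  by rewrite mxE; ring.
by rewrite pair_bigA; apply: eq_bigr => -[m n] _.
Qed.

Lemma gaussian_opnorm_tail (l : R) : (0 < M)%N -> (0 < N)%N -> 0 <= l ->
  5 * l <= Num.sqrt M%:R -> 5 * l <= Num.sqrt N%:R ->
  exists D : set vec, [/\ measurable D, (gaussv R J D <= (expR (1 - l ^+ 2 / 2))%:E)%E &
    forall v, ~ D v -> forall x,
      enorm (mx_of v *m x) <= (Num.sqrt M%:R + Num.sqrt N%:R + l) * enorm x].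
Proof.
move=> M0 N0 l0 lM lN.
set s := Num.sqrt M%:R + Num.sqrt N%:R + l.
have s0 : 0 <= s by rewrite !addr_ge0 ?sqrtr_ge0.
have ls : 0 <= l * s by rewrite mulr_ge0.
(* Mesh chosen so that the loss 2 delta l s in the exponent is at most 1/2; the added 1 keeps delta
   <= 1/4 even when [l * s] is 0. *)
pose delta := (4 * (1 + l * s))^-1.
have d0 : 0 < delta by rewrite invr_gt0; lra.
have dE : delta * (1 + l * s) = 4^-1 by rewrite /delta; field; lra.
have d1 : delta <= 4^-1 by rewrite -dE ler_peMr ?lerDl// ltW.
have [K [u [u1 netu]]] := @sphere_net R N delta d0.
have [L [w [w1 netw]]] := @sphere_net R M delta d0.
have [K0 L0] : (0 < #|K|)%N /\ (0 < #|L|)%N.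
  have unit n (n0 : (0 < n)%N) : enorm (delta_mx (Ordinal n0) 0 : 'cV[R]_n) = 1.
    rewrite /enorm /inner (bigD1 (Ordinal n0))//= !mxE !eqxx mulr1 big1 ?addr0 ?sqrtr1// => i i0.
    by rewrite !mxE (negbTE i0) mul0r.
  have [k _] := netu _ (unit _ N0); have [j _] := netw _ (unit _ M0).
  by split; apply/card_gt0P; [exists k|exists j].
have LK0 : (0 < #|{: L * K}|)%N by rewrite card_prod muln_gt0 L0.
set lnK := ln (#|{: L * K}|%:R : R).
have lnK0 : 0 <= lnK by rewrite ln_ge0// ler1n.
(* Makes the entropy term [al * lnK] at most 1/2 whatever the nets, and al <= 1 as Slepian's
   inequality requires; [be] then restores the product l. *)
pose al := (2 * (1 + lnK))^-1.
have al0 : 0 < al by rewrite invr_gt0; lra.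
have alE : al * (1 + lnK) = 2^-1 by rewrite /al; field; lra.
have al1 : al <= 2^-1 by rewrite -alE ler_peMr ?lerDl// ltW.
pose be := l / al.
have ab : al * be = l by rewrite /be mulrCA mulfV ?mulr1// gt_eqF.
have be0 : 0 <= be by rewrite divr_ge0// ltW.
pose s' := (1 - 2 * delta) * s.
pose D := \bigcup_(p in [set: L * K]) [set v : vec | s' <= dotv (bilinear_coef w u p) v].
have mD : measurable D.
  apply: fin_bigcup_measurable => // p _.
  rewrite -[X in measurable X]setTI; apply: (measurable_fun_ler _ _) => //.
  exact: measurable_dotv.
have := @chevet_expR R M N L K w u w1 u1 LK0 M0 N0 al be (ltW al0) _ be0.
rewrite ab => /(_ _ lM lN) chevet.
exists D; split => //.
- apply: le_trans (measure_le_expectation mD _ _ (expR_gt0 (l * s')) _ (chevet _)) _.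
  + apply: measurableT_comp => //; apply: measurable_funM => //.
    apply: measurableT_comp => //; apply: measurable_sum => p.
    by apply: measurableT_comp => //; apply: measurable_funM => //; exact: measurable_dotv.
  + by move=> v; exact: expR_ge0.
  + move=> v [p _ /= Dp]; rewrite ler_expR -ab -mulrA ler_wpM2l ?(ltW al0)//.
    by apply: le_trans (lse_ge LK0 _ p); exact: ler_wpM2l.
  + lra.
  (* The exponent is al lnK + l^2 / 2 - l^2 + 2 delta l s, and its first and last terms are at most
     1/2 each. *)
  + rewrite lee_fin -expRB ler_expR -/lnK /s' /s.
    have : al * lnK <= 2^-1 by move: alE; rewrite mulrDr mulr1; lra.
    have : delta * (l * s) <= 4^-1 by move: dE; rewrite mulrDr mulr1; lra.
    rewrite /s; lra.
- move=> v Dv x; have d2 : delta < 2^-1 by lra.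
  have -> : s = s' / (1 - 2 * delta) by rewrite /s' mulrC mulKf//; lra.
  apply: (@opnorm_le_net R M N N0 (mx_of v) delta s' K L u w netu netw w1 d2).
    by rewrite mulr_ge0//; lra.
  move=> k j; rewrite leNgt; apply/negP => h; apply: Dv; exists (j, k) => //=.
  by rewrite inner_mx_of in h; exact: ltW.
Qed.

End gaussian_matrix.

(** * Correlations between the columns *)

Section column_correlations.
Variables (R : realType) (M N : nat).
Local Notation J := ('I_M * 'I_N)%type.
Local Notation vec := (#|{: J}|.-tuple R).
Local Notation E := (@gaussv R J).

Lemma gaussv_expR_dotv (I : finType) (c : I -> R) :
  (\int[@gaussv R I]_v (expR (dotv c v))%:E = (expR (\sum_i c i ^+ 2 / 2))%:E)%E.
Proof.
have := @gaussv_shift R I c (fun=> (expR (\sum_i c i ^+ 2 / 2))%:E) (measurable_cst _).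
rewrite integral_cst//= probability_setT mule1 => ->; last by move=> v; rewrite lee_fin expR_ge0.
apply: eq_integral => v _; rewrite -EFinM -expRD; congr (expR _)%:E.
by rewrite -big_split /=; apply: eq_bigr => i _; rewrite addrC subrK.
Qed.

Definition colnorm (j : 'I_N) (v : vec) : R := bnorm [pred q : J | q.2 == j] v.

Lemma sum_col (j : 'I_N) (f : J -> R) : \sum_(q | q.2 == j) f q = \sum_(m < M) f (m, j).
Proof.
rewrite (eq_bigr (fun q => f (q.1, q.2))); last by case.
rewrite -(pair_big xpredT (fun n => n == j) (fun m n => f (m, n))) /=.
by apply: eq_bigr => m _; rewrite big_pred1_eq.
Qed.

(** Chernoff's bound with parameter -th: the transform (1 + 2 th)^(-M/2) is at most exp (M (th^2 -
    th)) by [ln1D_ge], and the threshold adds th (M - 2 M th). *)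
Lemma gaussv_colnorm_tail (j : 'I_N) (th : R) : 0 <= th ->
  (E [set v | colnorm j v ^+ 2 < M%:R - 2 * M%:R * th]%R <= (expR (- (M%:R * th ^+ 2)))%:E)%E.
Proof.
move=> th0.
have sqE v : colnorm j v ^+ 2 = \sum_(q | q.2 == j) crd q v ^+ 2.
  by rewrite sqr_sqrtr// sumr_ge0// => q _; exact: sqr_ge0.
pose x (q : J) := if q.2 == j then - (2 * th) else 0.
have xs v : \sum_q x q * crd q v ^+ 2 / 2 = - th * colnorm j v ^+ 2.
  rewrite sqE [in RHS]big_mkcond mulr_sumr; apply: eq_bigr => q _; rewrite /x; case: ifP => _.
    by field.
  by rewrite !mul0r mulr0.
set a := M%:R - 2 * M%:R * th.
have mc : measurable_fun setT (fun v : vec => colnorm j v ^+ 2).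
  by apply: measurable_funX; exact: measurable_bnorm.
have mD : measurable [set v : vec | colnorm j v ^+ 2 < a].
  rewrite -[X in measurable X]setTI.
  exact: (measurable_fun_ltr mc (measurable_cst a)).
apply: le_trans (measure_le_expectation (f := fun v => expR (- th * colnorm j v ^+ 2))
  (c := expR (- th * a)) (r := expR (M%:R * (- th + th ^+ 2))) mD _ _ (expR_gt0 _) _ _) _.
- by apply: measurableT_comp => //; exact: measurable_funM.
- by move=> v; exact: expR_ge0.
- by move=> v /= /ltW va; rewrite ler_expR !mulNr lerN2 ler_wpM2l.
- under eq_integral do rewrite -xs.
  rewrite gaussv_expR_sumsq; last by move=> q; rewrite /x; case: ifP => _; lra.
  rewrite lee_fin (bigID (fun q => q.2 == j))/= [X in _ * X]big1 ?mulr1; last first.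
    by move=> q qj; rewrite /x (negbTE qj) subr0 sqrtr1 invr1.
  apply: (@le_trans _ _ (\prod_(q : J | q.2 == j) expR (- th + th ^+ 2))).
    apply: ler_prod => q qj; rewrite invr_ge0 sqrtr_ge0 /x qj opprK /=.
    have t1 : 0 < 1 + 2 * th by lra.
    rewrite -[leRHS]invrK lef_pV2 ?posrE ?invr_gt0 ?expR_gt0 ?sqrtr_gt0// -expRN.
    rewrite -ler_sqr ?nnegrE ?expR_ge0 ?sqrtr_ge0// sqr_sqrtr; last exact: ltW.
    rewrite expr2 -expRD -[leRHS]lnK ?posrE// ler_expR.
    have := @ln1D_ge R (2 * th); rewrite mulr_ge0// => /(_ isT).
    rewrite exprMn; lra.
  by rewrite -expR_sum sum_col sumr_const card_ord mulr_natl.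
rewrite -expRB lee_fin ler_expR /a le_eqVlt; apply/orP; left; apply/eqP; ring.
Qed.

Definition direction (i : 'I_N) (m : 'I_M) (v : vec) : R := crd ((m, i) : J) v / colnorm i v.

Definition proj (i j : 'I_N) (v : vec) : R := \sum_(m < M) direction i m v * crd ((m, j) : J) v.

(** Here [proj i j] is <f_i, g_j>. The truncated denominator depends on column [j] through its norm
    only, so [corr] is odd under [flip j], just like [proj]. *)
Definition corr (c : R) (i j : 'I_N) (v : vec) : R := proj i j v / Num.max (colnorm j v) c.

Definition flip (j : 'I_N) (v : vec) : vec :=
  tup (fun q : J => if q.2 == j then - crd q v else crd q v).

Lemma measurable_colnorm j : measurable_fun setT (colnorm j).
Proof. exact: measurable_bnorm. Qed.

Lemma measurable_inv d (T : measurableType d) (f : T -> R) :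
  (forall t, 0 <= f t) -> measurable_fun setT f -> measurable_fun setT (fun t => (f t)^-1).
Proof.
move=> f0 mf; under eq_fun do rewrite -powR_inv1//.
exact: (measurableT_comp (measurable_powR _) mf).
Qed.

Lemma measurable_direction i m : measurable_fun setT (direction i m).
Proof.
apply: measurable_funM; first exact: measurable_crd.
by apply: measurable_inv => [v|]; [exact: sqrtr_ge0|exact: measurable_colnorm].
Qed.

Lemma measurable_proj i j : measurable_fun setT (proj i j).
Proof.
apply: measurable_sum => m; apply: measurable_funM; first exact: measurable_direction.
exact: measurable_crd.
Qed.

Lemma measurable_corr c i j : measurable_fun setT (corr c i j).
Proof.
apply: measurable_funM; first exact: measurable_proj.
apply: measurable_inv => [v|]; first by rewrite le_max sqrtr_ge0.
by apply: measurable_maxr => //; exact: measurable_colnorm.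
Qed.

Lemma colnorm_flip j k v : colnorm j (flip k v) = colnorm j v.
Proof.
rewrite /colnorm /bnorm; congr Num.sqrt; apply: eq_bigr => q _.
by rewrite crd_tup; case: ifP => // _; rewrite sqrrN.
Qed.

Lemma direction_flip i m k v : i != k -> direction i m (flip k v) = direction i m v.
Proof. by move=> ik; rewrite /direction colnorm_flip crd_tup /= (negbTE ik). Qed.

Lemma proj_flip i j k v : i != k ->
  proj i j (flip k v) = if j == k then - proj i j v else proj i j v.
Proof.
move=> ik; transitivity (\sum_(m < M) direction i m v * crd ((m, j) : J) (flip k v)).
  by apply: eq_bigr => m _; rewrite direction_flip.
under eq_bigr do rewrite crd_tup /=; case: ifP => // _.
by under eq_bigr do rewrite mulrN; rewrite sumrN.
Qed.

Lemma corr_flip c i j k v : i != k ->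
  corr c i j (flip k v) = if j == k then - corr c i j v else corr c i j v.
Proof.
by move=> ik; rewrite /corr colnorm_flip proj_flip//; case: ifP => // _; rewrite mulNr.
Qed.

Lemma corr_le c i j v : 0 < c -> `|corr c i j v| <= `|proj i j v| / c.
Proof.
move=> c0; have cm : c <= Num.max (colnorm j v) c by rewrite le_max lexx orbT.
have m0 := lt_le_trans c0 cm.
by rewrite /corr normrM normfV (gtr0_norm m0) ler_wpM2l// lef_pV2 ?posrE.
Qed.

(** For 0 <= a <= b the difference factors as (exp b - exp a) (1 - exp (- a) exp (- b)). *)
Lemma expRD_expRN_le (a b : R) : `|a| <= `|b| -> expR a + expR (- a) <= expR b + expR (- b).
Proof.
wlog : a b / 0 <= a <= b => [hw|/andP[a0 ab] _].
  have hn (x : R) : expR x + expR (- x) = expR `|x| + expR (- `|x|).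
    by have [x0|x0] := ger0P x => //; rewrite opprK addrC.
  move=> ab; rewrite hn (hn b); apply: hw; rewrite ?normr_ge0//.
  by rewrite !normr_id.
have h1 : expR a <= expR b by rewrite ler_expR.
have h2 : expR (- a) * expR (- b) <= 1 by rewrite -expRD -expR0 ler_expR; lra.
have ea : expR a * expR (- a) = 1 by rewrite -expRD subrr expR0.
have eb : expR b * expR (- b) = 1 by rewrite -expRD subrr expR0.
have := mulr_ge0 (_ : 0 <= expR b - expR a) (_ : 0 <= 1 - expR (- a) * expR (- b)).
rewrite !subr_ge0 => /(_ h1 h2).
have -> : (expR b - expR a) * (1 - expR (- a) * expR (- b)) = expR b - expR a
   - (expR b * expR (- b)) * expR (- a) + (expR a * expR (- a)) * expR (- b) by ring.
rewrite ea eb; lra.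
Qed.

(* Averaging over the sign of the column [j] replaces the exponential by a
   hyperbolic cosine, which is monotone in the absolute value. *)
Lemma corr_step (c s : R) (i j : 'I_N) (f : vec -> R) : 0 < c -> i != j ->
  measurable_fun setT f -> (forall v, 0 <= f v) -> (forall v, f (flip j v) = f v) ->
  (\int[E]_v (f v * expR (s * corr c i j v))%:E <=
   \int[E]_v (f v * expR (s / c * proj i j v))%:E)%E.
Proof.
move=> c0 ij mf f0 ff.
have key (g : vec -> R) : measurable_fun setT g -> (forall v, g (flip j v) = - g v) ->
    (2%:E * \int[E]_v (f v * expR (g v))%:E =
     \int[E]_v (f v * (expR (g v) + expR (- g v)))%:E)%E.
  move=> mg gf.
  have mh (h : vec -> R) : measurable_fun setT h ->
      measurable_fun setT (fun v => (f v * expR (h v))%:E).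
    by move=> mh; apply/measurable_EFinP; apply: measurable_funM => //; exact: measurableT_comp.
  have mN : measurable_fun setT (fun v => - g v) by exact: measurable_funN.
  have h0 (h : vec -> R) v : (0 <= (f v * expR (h v))%:E)%E.
    by rewrite lee_fin mulr_ge0// expR_ge0.
  have := @gaussv_flip R J (fun q => q.2 == j) _ (mh g mg) (h0 g).
  under eq_integral do rewrite -/(flip j _) ff gf.
  move=> hN; rewrite mule_natl mule2n -{1}hN.
  rewrite -(ge0_integralD _ measurableT (fun v _ => h0 (fun v => - g v) v) (mh _ mN)
    (fun v _ => h0 g v) (mh _ mg)).
  by apply: eq_integral => v _; rewrite -EFinD; congr _%:E; ring.
have m1 : measurable_fun setT (fun v => s * corr c i j v).
  by apply: measurable_funM => //; exact: measurable_corr.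
have m2 : measurable_fun setT (fun v => s / c * proj i j v).
  by apply: measurable_funM => //; exact: measurable_proj.
have e2 : (0 < 2%:E :> \bar R)%E by rewrite lte_fin.
suff : (2%:E * \int[E]_v (f v * expR (s * corr c i j v))%:E <=
    2%:E * \int[E]_v (f v * expR (s / c * proj i j v))%:E)%E.
  by rewrite (@lee_pmul2l R 2%:E isT e2).
rewrite (key _ m1); last by move=> v; rewrite corr_flip// eqxx mulrN.
rewrite (key _ m2); last by move=> v; rewrite proj_flip// eqxx mulrN.
have mcosh (h : vec -> R) : measurable_fun setT h ->
    measurable_fun setT (fun v => (f v * (expR (h v) + expR (- h v)))%:E).
  move=> mh; apply/measurable_EFinP; apply: measurable_funM => //.
  apply: measurable_funD; first exact: measurableT_comp.
  by apply: measurableT_comp => //; exact: measurable_funN.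
apply: ge0_le_integral => //.
- by move=> v _; rewrite lee_fin mulr_ge0// addr_ge0// expR_ge0.
- exact: mcosh.
- exact: mcosh.
- move=> v _; rewrite lee_fin ler_wpM2l// expRD_expRN_le//.
  rewrite -mulrA (normrM s) (normrM s (c^-1 * _)) ler_wpM2l//.
  by rewrite (normrM c^-1) normfV (gtr0_norm c0) mulrC corr_le.
Qed.

End column_correlations.

Section column_correlations_tail.
Variables (R : realType) (M N : nat).
Local Notation J := ('I_M * 'I_N)%type.
Local Notation vec := (#|{: J}|.-tuple R).
Local Notation E := (@gaussv R J).

(** Columns are treated one at a time by [corr_step]. The factor [f] is what makes the induction go
    through: it collects the columns already replaced, which are invariant under the flips still to
    come. *)
Lemma corr_chain (c s : R) (i : 'I_N) (r : seq 'I_N) (f : vec -> R) :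
  0 < c -> i \notin r -> uniq r ->
  measurable_fun setT f -> (forall v, 0 <= f v) ->
  (forall j, j \in r -> forall v, f (flip j v) = f v) ->
  (\int[E]_v (f v * expR (s * \sum_(j <- r) corr c i j v))%:E <=
   \int[E]_v (f v * expR (s / c * \sum_(j <- r) proj i j v))%:E)%E.
Proof.
move=> c0; elim: r f => [|j r IH] f.
  move=> _ _ _ _ _; rewrite le_eqVlt; apply/orP; left; apply/eqP.
  by apply: eq_integral => v _; rewrite !big_nil !mulr0.
rewrite inE negb_or => /andP[ij ir] /= /andP[jr ur] mf f0 ff.
(* [f1] holds the columns still waiting and is the factor for the step at [j]; [f2] holds the
   replaced column [j] and is the factor for the induction hypothesis. *)
pose f1 v := f v * expR (s * \sum_(k <- r) corr c i k v).
pose f2 v := f v * expR (s / c * proj i j v).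
have mf1 : measurable_fun setT f1.
  apply: measurable_funM => //; apply: measurableT_comp => //.
  by apply: measurable_funM => //; apply: measurable_sum => k; exact: measurable_corr.
have mf2 : measurable_fun setT f2.
  apply: measurable_funM => //; apply: measurableT_comp => //.
  by apply: measurable_funM => //; exact: measurable_proj.
have f10 v : 0 <= f1 v by rewrite mulr_ge0// expR_ge0.
have f20 v : 0 <= f2 v by rewrite mulr_ge0// expR_ge0.
have f1f v : f1 (flip j v) = f1 v.
  rewrite /f1 ff ?inE ?eqxx//; congr (_ * expR (_ * _)); apply: eq_big_seq => k kr.
  by rewrite corr_flip//; case: eqP => // kj; rewrite kj (negbTE jr) in kr.
have f2f k : k \in r -> forall v, f2 (flip k v) = f2 v.
  move=> kr v; rewrite /f2 ff ?inE ?kr ?orbT// proj_flip.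
    by case: eqP => // jk; rewrite jk kr in jr.
  by apply: contraNneq ir => ->.
have e1 : (\int[E]_v (f v * expR (s * \sum_(j0 <- j :: r) corr c i j0 v))%:E =
    \int[E]_v (f1 v * expR (s * corr c i j v))%:E)%E.
  apply: eq_integral => v _; congr _%:E.
  by rewrite /f1 -mulrA -expRD -mulrDr big_cons addrC.
have e2 : (\int[E]_v (f1 v * expR (s / c * proj i j v))%:E =
    \int[E]_v (f2 v * expR (s * \sum_(k <- r) corr c i k v))%:E)%E.
  by apply: eq_integral => v _; congr _%:E; rewrite /f1 /f2 mulrAC.
have e3 : (\int[E]_v (f2 v * expR (s / c * \sum_(k <- r) proj i k v))%:E =
    \int[E]_v (f v * expR (s / c * \sum_(j0 <- j :: r) proj i j0 v))%:E)%E.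
  apply: eq_integral => v _; congr _%:E.
  by rewrite /f2 -mulrA -expRD -mulrDr big_cons.
rewrite e1 -e3; apply: (le_trans (corr_step s c0 ij mf1 f10 f1f)).
by rewrite e2; exact: IH.
Qed.

(** An inequality because a zero column has direction 0. *)
Lemma sum_sqr_direction (i : 'I_N) (v : vec) : \sum_(m < M) direction i m v ^+ 2 <= 1.
Proof.
under eq_bigr do rewrite /direction expr_div_n.
rewrite -mulr_suml -(@sum_col R M N i (fun q => crd q v ^+ 2)).
rewrite /colnorm sqr_sqrtr; last by apply: sumr_ge0 => q _; exact: sqr_ge0.
set a := \sum_(_ | _) _; have [->|a0] := eqVneq a 0; first by rewrite mul0r.
by rewrite mulfV.
Qed.

Lemma sum_cols (r : seq 'I_N) (f : J -> R) : uniq r ->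
  \sum_q (if q.2 \in r then f q else 0) = \sum_(j <- r) \sum_(m < M) f (m, j).
Proof.
move=> ur; rewrite [RHS]big_uniq//= exchange_big /=.
rewrite (eq_bigr (fun q : J => if q.2 \in r then f (q.1, q.2) else 0)); last by case.
rewrite -(pair_bigA _ (fun m n => if n \in r then f (m, n) else 0)) /=.
by apply: eq_bigr => m _; rewrite -big_mkcond.
Qed.

(** Resample the columns of [r] with column [i] frozen, as [i] is outside [r]. The sum becomes a
    centred Gaussian of variance [size r] times |f_i|^2, and |f_i| is at most 1. *)
Lemma gaussv_expR_sum_proj (t : R) (i : 'I_N) (r : seq 'I_N) : i \notin r -> uniq r ->
  (\int[E]_v (expR (t * \sum_(j <- r) proj i j v))%:E <=
   (expR (t ^+ 2 * (size r)%:R / 2))%:E)%E.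
Proof.
move=> ir ur; set h := fun v : vec => (expR (t * \sum_(j <- r) proj i j v))%:E.
have mh : measurable_fun setT h.
  apply/measurable_EFinP; apply: measurableT_comp => //.
  by apply: measurable_funM => //; apply: measurable_sum => k; exact: measurable_proj.
have h0 v : (0 <= h v)%E by rewrite lee_fin expR_ge0.
rewrite (@gaussv_mix R J (fun q => q.2 \in r) h mh h0).
pose a (u : vec) (q : J) := if q.2 \in r then t * direction i q.1 u else 0.
have hE u v : h (tup (fun q => if q.2 \in r then crd q v else crd q u)) =
    (expR (dotv (a u) v))%:E.
  set w := tup _.
  have ci : colnorm i w = colnorm i u.
    rewrite /colnorm /bnorm; congr Num.sqrt; apply: eq_bigr => q /eqP qi.
    by rewrite crd_tup qi (negbTE ir).
  have di m : direction i m w = direction i m u.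
    by rewrite /direction ci crd_tup /= (negbTE ir).
  rewrite /h /dotv; congr (expR _)%:E.
  rewrite (eq_bigr (fun q => if q.2 \in r then t * direction i q.1 u * crd q v else 0)); last first.
    by move=> q _; rewrite /a; case: ifP => // _; rewrite mul0r.
  rewrite sum_cols// mulr_sumr; apply: eq_big_seq => j jr.
  rewrite mulr_sumr; apply: eq_bigr => m _.
  by rewrite di crd_tup /= jr mulrA.
under eq_integral => u _.
  rewrite (_ : integral _ _ _ = (expR (\sum_q a u q ^+ 2 / 2))%:E); last first.
    rewrite -gaussv_expR_dotv; apply: eq_integral => v _; exact: hE.
  over.
have ale u : \sum_q a u q ^+ 2 / 2 <= t ^+ 2 * (size r)%:R / 2.
  rewrite -mulr_suml ler_pM2r//.
  rewrite (eq_bigr (fun q => if q.2 \in r then (t * direction i q.1 u) ^+ 2 else 0)); last first.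
    by move=> q _; rewrite /a; case: ifP => // _; rewrite expr0n.
  rewrite sum_cols// -sum1_size natr_sum mulr_sumr.
  apply: ler_sum => j _; rewrite mulr1 -[leRHS]mulr1.
  under eq_bigr do rewrite exprMn /=.
  by rewrite -mulr_sumr ler_wpM2l ?sqr_ge0// sum_sqr_direction.
apply: (@le_trans _ _ (\int[E]_u (expR (t ^+ 2 * (size r)%:R / 2))%:E)%E).
  apply: ge0_le_integral => //.
  - apply/measurable_EFinP; apply: measurableT_comp => //.
    apply: measurable_sum => q; apply: measurable_funM => //.
    apply: measurable_funX; rewrite /a; case: (q.2 \in r) => //.
    by apply: measurable_funM => //; exact: measurable_direction.
  - by move=> u _; rewrite lee_fin ler_expR.
by rewrite integral_cst//= probability_setT mule1.
Qed.

Lemma measurable_corr_tail (c t : R) (i : 'I_N) (r : seq 'I_N) :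
  measurable [set v : vec | t <= `|\sum_(j <- r) corr c i j v|].
Proof.
rewrite -[X in measurable X]setTI; apply: (measurable_fun_ler _ _) => //.
apply: measurableT_comp => //; apply: measurable_sum => k; exact: measurable_corr.
Qed.

Lemma gaussv_corr_tail (c t : R) (i : 'I_N) (r : seq 'I_N) :
  0 < c -> 0 <= t -> i \notin r -> uniq r -> (0 < size r)%N ->
  (E [set v | t <= `|\sum_(j <- r) corr c i j v|]%R <=
   (2 * expR (- (t ^+ 2 * c ^+ 2 / (2 * (size r)%:R))))%:E)%E.
Proof.
move=> c0 t0 ir ur r0.
pose S (v : vec) := \sum_(j <- r) corr c i j v.
have mS : measurable_fun setT S by apply: measurable_sum => k; exact: measurable_corr.
pose n : R := (size r)%:R; have n0 : 0 < n by rewrite ltr0n.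
have mgf s : (\int[E]_v (expR (s * S v))%:E <= (expR ((s / c) ^+ 2 * n / 2))%:E)%E.
  apply: le_trans (gaussv_expR_sum_proj (s / c) ir ur).
  have := @corr_chain c s i r (fun=> 1) c0 ir ur (measurable_cst _) (fun=> ler01) (fun _ _ _ => erefl).
  by under eq_integral do rewrite mul1r; under [X in (_ <= X)%E]eq_integral do rewrite mul1r.
have one b : `|b| = 1 -> (E [set v | t <= b * S v]%R <= (expR (- (t ^+ 2 * c ^+ 2 / (2 * n))))%:E)%E.
  (* The minimiser of (s / c)^2 n / 2 - s t. The sign [b] serves the two tails at once. *)
  move=> b1; pose s := t * c ^+ 2 / n.
  have s0 : 0 <= s by rewrite divr_ge0 ?mulr_ge0 ?sqr_ge0// ltW.
  have b2 : b ^+ 2 = 1 by rewrite -real_normK ?num_real// b1 expr1n.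
  apply: le_trans (measure_le_expectation (f := fun v => expR (s * b * S v))
    (c := expR (s * t)) (r := expR ((s * b / c) ^+ 2 * n / 2)) _ _ _ (expR_gt0 _) _ (mgf _)) _.
  - rewrite -[X in measurable X]setTI; apply: (measurable_fun_ler _ _) => //.
    exact: measurable_funM.
  - by apply: measurableT_comp => //; exact: measurable_funM.
  - by move=> v; exact: expR_ge0.
  - by move=> v /= h; rewrite ler_expR -mulrA ler_wpM2l.
  - rewrite -expRB lee_fin ler_expR le_eqVlt; apply/orP; left; apply/eqP.
    rewrite !exprMn b2 /s; field; rewrite !gt_eqF//.
have mle b : measurable [set v | t <= b * S v].
  rewrite -[X in measurable X]setTI; apply: (measurable_fun_ler _ _) => //.
  exact: measurable_funM.
rewrite (_ : [set v | _] = [set v | t <= 1 * S v] `|` [set v | t <= (-1) * S v]); last first.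
  apply/seteqP; split => v /=; rewrite mul1r mulN1r -/(S v) ler_normr.
    by move=> /orP[]; [left|right].
  by move=> h; apply/orP; case: h; [left|right].
apply: (le_trans (measureU2 _ _ _)); [exact: mle|exact: mle|].
rewrite mulr_natl mulr2n EFinD; apply: leeD; apply: one; first by rewrite normr1.
by rewrite normrN1.
Qed.

End column_correlations_tail.

(** * The normalized frame *)

Lemma measure_bigcup_le (R : realType) d (T : measurableType d)
    (P : {measure set T -> \bar R}) (I : finType) (A : I -> set T) (x : R) :
  (forall i, measurable (A i)) -> (forall i, P (A i) <= x%:E)%E ->
  (P (\bigcup_(i in [set: I]) A i) <= (#|I|%:R * x)%:E)%E.
Proof.
move=> mA PA; rewrite (_ : [set: I] = [set` enum I]); last first.
  by apply/seteqP; split => i //= _; rewrite mem_enum.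
rewrite bigcup_seq cardE; elim: (enum I) => [|i r IH].
  by rewrite big_nil measure0 mul0r.
rewrite big_cons (le_trans (measureU2 _ (mA i) _))//.
  by apply: bigsetU_measurable => k _; exact: mA.
by rewrite [size _]/= -natr1 mulrDl mul1r addrC EFinD; exact: leeD IH (PA i).
Qed.

Lemma measurable_bigmax (R : realType) d (T : measurableType d) (I : Type) (r : seq I)
    (S : pred I) (f : I -> T -> R) :
  (forall i, measurable_fun setT (f i)) ->
  measurable_fun setT (fun t => \big[Num.max/0]_(i <- r | S i) f i t).
Proof.
move=> mf; elim: r => [|i r IH].
  by under eq_fun do rewrite big_nil; exact: measurable_cst.
by under eq_fun do rewrite big_cons; case: (S i) => //; apply: measurable_maxr.
Qed.

Section normalized_frame.
Variables (R : realType) (M N : nat).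
Local Notation J := ('I_M * 'I_N)%type.
Local Notation vec := (#|{: J}|.-tuple R).

Definition frame (v : vec) : 'M[R]_(M, N) := normalize_columns (mx_of v).

Lemma enorm_col_mx_of j (v : vec) : enorm (col j (mx_of v)) = colnorm j v.
Proof.
rewrite /colnorm /bnorm /= (@sum_col R M N j (fun q => crd q v ^+ 2)).
by congr Num.sqrt; apply: eq_bigr => m _; rewrite !mxE expr2.
Qed.

Lemma frameE (v : vec) m j : frame v m j = direction j m v.
Proof. by rewrite mxE enorm_col_mx_of mxE. Qed.

Lemma inner_col_frame (v : vec) i j :
  inner (col i (frame v)) (col j (frame v)) = proj i j v / colnorm j v.
Proof.
rewrite /proj mulr_suml; apply: eq_bigr => m _.
by rewrite ![col _ _ _ _]mxE !frameE {2}/direction mulrA.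
Qed.

Lemma measurable_inner_frame (w : 'cV[R]_M) (u : 'cV[R]_N) :
  measurable_fun setT (fun v => inner w (frame v *m u)).
Proof.
apply: measurable_sum => m; apply: measurable_funM => //.
under eq_fun do rewrite mxE; apply: measurable_sum => n; apply: measurable_funM => //.
by under eq_fun do rewrite frameE; exact: measurable_direction.
Qed.

Lemma measurable_inner_col_frame i j :
  measurable_fun setT (fun v => inner (col i (frame v)) (col j (frame v))).
Proof.
under eq_fun do rewrite inner_col_frame.
apply: measurable_funM; first exact: measurable_proj.
by apply: measurable_inv => [v|]; [exact: sqrtr_ge0|exact: measurable_colnorm].
Qed.

Lemma measurable_worst_case_coherence_frame :
  measurable_fun setT (fun v => worst_case_coherence (frame v)).
Proof.
apply: measurable_bigmax => p.
by apply: measurableT_comp => //; exact: measurable_inner_col_frame.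
Qed.

Lemma measurable_average_coherence_frame :
  measurable_fun setT (fun v => average_coherence (frame v)).
Proof.
apply: measurable_funM => //; apply: measurable_bigmax => i.
apply: measurableT_comp => //.
under eq_fun do rewrite big_mkcond.
apply: measurable_sum => j; case: (j != i) => //; exact: measurable_inner_col_frame.
Qed.

(* The bound on the spectral norm is tested on finer and finer finite nets. *)
Lemma measurable_spectral_norm_frame (c : R) : (0 < N)%N -> 0 <= c ->
  measurable [set v | spectral_norm (frame v) <= c].
Proof.
(* The offset 4 keeps [delta k] below 1/2 for every [k], as [opnorm_le_net] demands. *)
move=> N0 c0; pose delta k : R := (k.+4%:R)^-1.
have d0 k : 0 < delta k by rewrite invr_gt0 ltr0n.
have d2 k : delta k < 2^-1 by rewrite ltf_pV2 ?posrE ?ltr0n// ltr_nat.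
have approx k : exists B : set vec, [/\ measurable B,
    [set v | spectral_norm (frame v) <= c] `<=` B &
    B `<=` [set v | spectral_norm (frame v) <= c / (1 - 2 * delta k)]].
  have [K [u [u1 netu]]] := @sphere_net R N _ (d0 k).
  have [L [w [w1 netw]]] := @sphere_net R M _ (d0 k).
  (* Finitely many measurable conditions, implied by the bound c and implying c / (1 - 2 delta k);
     these sets therefore intersect, over [k], in the event sought. *)
  exists (\bigcap_(p in [set: K * L]) [set v | inner (w p.2) (frame v *m u p.1) <= c]); split.
  - apply: fin_bigcap_measurable => // p _; rewrite -[X in measurable X]setTI.
    apply: (measurable_fun_ler _ _) => //; exact: measurable_inner_frame.
  - move=> v /= /(spectral_norm_leP N0 (frame v) c0) Fc p _ /=.
    apply: le_trans (ler_inner _ _) _; rewrite w1 mul1r.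
    by apply: le_trans (Fc _) _; rewrite u1 mulr1.
  - move=> v Bv /=; apply/(spectral_norm_leP N0).
      by rewrite divr_ge0// subr_ge0; have := d2 k; lra.
    apply: (@opnorm_le_net R M N N0 (frame v) (delta k) c K L u w netu netw w1 (d2 k) c0).
    by move=> a b; exact: (Bv (a, b)).
have [B BP] := boolp.choice approx.
rewrite (_ : mkset _ = \bigcap_k B k).
  by apply: bigcapT_measurable => k; have [] := BP k.
apply/seteqP; split=> [v vc k _|v vB /=]; first by have [_ + _] := BP k; exact.
set s := spectral_norm _; rewrite leNgt; apply/negP => cs.
have sk k : s * (1 - 2 * delta k) <= c.
  have [_ _ /(_ v (vB k I)) /=] := BP k.
  by rewrite ler_pdivlMr// subr_gt0; have := d2 k; lra.
have e0 : 0 < s - c by rewrite subr_gt0.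
have s0 : 0 <= s by lra.
(* If s > c, then s (1 - 2 / (k + 4)) <= c says (s - c) (k + 4) <= 2 s, which fails for large
   [k]. *)
have := archi_boundP (_ : 0 <= 2 * s / (s - c)).
rewrite divr_ge0 ?mulr_ge0// 1?ltW// => /(_ isT); set k := Num.bound _ => sc.
have := sk k; rewrite ltr_pdivrMr// in sc.
have k4 : 0 < k.+4%:R :> R by rewrite ltr0n.
rewrite -subr_ge0 => h.
have : 0 <= (c - s * (1 - 2 * delta k)) * k.+4%:R by rewrite mulr_ge0// ltW.
have -> : (c - s * (1 - 2 * delta k)) * k.+4%:R = 2 * s - (s - c) * k.+4%:R.
  by rewrite /delta; field; rewrite gt_eqF.
have : (s - c) * k%:R <= (s - c) * k.+4%:R.
  by rewrite ler_wpM2l// ?(ltW e0)// ler_nat -[k.+4]addn4 leq_addr.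
rewrite (mulrC (s - c) k%:R); lra.
Qed.

Definition good_frame (c1 c2 c3 : R) (F : 'M[R]_(M, N)) : Prop :=
  [/\ worst_case_coherence F <= c1, average_coherence F <= c2 & spectral_norm F <= c3].

Lemma measurable_good_frame (c1 c2 c3 : R) : (0 < N)%N -> 0 <= c3 ->
  measurable [set v | good_frame c1 c2 c3 (frame v)].
Proof.
move=> N0 c30.
rewrite (_ : mkset _ = [set v | worst_case_coherence (frame v) <= c1] `&`
  ([set v | average_coherence (frame v) <= c2] `&` [set v | spectral_norm (frame v) <= c3])).
  apply: measurableI; last apply: measurableI; last exact: measurable_spectral_norm_frame.
  - rewrite -[X in measurable X]setTI; apply: (measurable_fun_ler _ _) => //.
    exact: measurable_worst_case_coherence_frame.
  - rewrite -[X in measurable X]setTI; apply: (measurable_fun_ler _ _) => //.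
    exact: measurable_average_coherence_frame.
by apply/seteqP; split => v /= [? []].
Qed.

(** The frame is a function of the entries of [G], so the event has the probability it has under
    [gaussv]; from here on the original space disappears. *)
Lemma probability_gaussian_frame d (T : measurableType d) (P : probability T R)
    (G : 'I_M -> 'I_N -> {RV P >-> R}) (S : set 'M[R]_(M, N)) :
  iid_gaussian_matrix G -> measurable [set v | S (frame v)] ->
  P [set w | S (normalized_gaussian_frame G w)] = gaussv R J [set v | S (frame v)].
Proof.
move=> [indG gG] mS.
pose X w : vec := tup (fun q : J => G q.1 q.2 w).
have XE w : normalized_gaussian_frame G w = frame (X w).
  by congr normalize_columns; apply/matrixP => m n; rewrite !mxE crd_tup.
have mX : measurable_fun setT X by apply: measurable_tup => q.
have mXS : measurable (X @^-1` [set v | S (frame v)]).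
  by rewrite -[X in measurable X]setTI; exact: mX.
have := @ge0_integral_gaussv_iid R J d T P (fun q => G q.1 q.2)
  (fun v => (\1_[set v | S (frame v)] v)%:E) indG (fun q => gG q.1 q.2) _ _.
rewrite integral_indic// setIT => ->; last 2 first.
- exact/measurable_EFinP/measurable_indic.
- by move=> v; rewrite lee_fin.
transitivity (\int[P]_t (\1_(X @^-1` [set v | S (frame v)]) t)%:E)%E.
  rewrite integral_indic// setIT; congr (P _); apply/funext => w /=.
  by rewrite XE.
by apply: eq_integral => w _; rewrite !indicE; congr (_%:R%:E); apply/idP/idP; rewrite !inE.
Qed.

End normalized_frame.

Section good_frame.
Variables (R : realType) (M N : nat).
Local Notation J := ('I_M * 'I_N)%type.
Local Notation vec := (#|{: J}|.-tuple R).

(** The deterministic half. When all norms reach [c] the truncation is inactive and [corr] is the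
    true inner product. For the spectral norm, F x = G y with y_n = x_n / |g_n|, so |y| <= |x| /
    c. *)
Lemma good_frame_of_corr (v : vec) (c c1 c2 s : R) :
  0 < c -> 0 <= c1 -> 0 <= c2 -> 0 <= s -> (1 < N)%N ->
  (forall j, c ^+ 2 <= colnorm j v ^+ 2) ->
  (forall i j, i != j -> `|corr c i j v| <= c1) ->
  (forall i, `|\sum_(j < N | j != i) corr c i j v| <= (N%:R - 1) * c2) ->
  (forall x, enorm (mx_of v *m x) <= s * enorm x) ->
  good_frame c1 c2 (s / c) (frame v).
Proof.
move=> c0 c10 c20 s0 N1 cn h1 h2 h3.
have cj j : c <= colnorm j v.
  by rewrite -ler_sqr ?nnegrE ?(ltW c0) ?sqrtr_ge0.
have innerE i j : inner (col i (frame v)) (col j (frame v)) = corr c i j v.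
  by rewrite inner_col_frame /corr (max_l (cj j)).
split.
- by apply: bigmax_le => // -[i j] /= ij; rewrite innerE h1.
- have N0 : 0 < N%:R - 1 :> R by rewrite subr_gt0 ltr1n.
  rewrite /average_coherence mulrC ler_pdivrMr// mulrC.
  apply: bigmax_le => [|i _]; first by rewrite mulr_ge0// ltW.
  by under eq_bigr do rewrite innerE; exact: h2.
- have N0 : (0 < N)%N by exact: ltnW.
  apply/(spectral_norm_leP N0); first by rewrite divr_ge0// ltW.
  move=> x; pose y : 'cV[R]_N := \col_n (x n 0 / colnorm n v).
  have -> : frame v *m x = mx_of v *m y.
    apply/matrixP => m k; rewrite !mxE; apply: eq_bigr => n _.
    by rewrite frameE !mxE (ord1 k) /direction; ring.
  apply: le_trans (h3 y) _; rewrite -mulrA ler_wpM2l//.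
  rewrite -ler_sqr ?nnegrE ?mulr_ge0 ?enorm_ge0 ?invr_ge0 ?(ltW c0)//.
  rewrite exprMn !sqr_enorm /inner mulr_sumr; apply: ler_sum => n _.
  rewrite !mxE -!expr2 exprMn mulrC ler_wpM2r ?sqr_ge0//.
  by rewrite ler_sqr ?nnegrE ?invr_ge0 ?(ltW c0) ?sqrtr_ge0// lef_pV2 ?posrE ?(lt_le_trans c0 (cj n)).
Qed.

End good_frame.

(** * Numerical constants and the union bound *)

Lemma expR_half_le2 (R : realType) : expR (2^-1) <= 2 :> R.
Proof.
have h : 2^-1 <= expR (- 2^-1) :> R by have := expR_ge1Dx (- 2^-1 : R); lra.
by move: h; rewrite expRN lef_pV2 ?posrE ?expR_gt0.
Qed.

Lemma expR1_le4 (R : realType) : expR 1 <= 4 :> R.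
Proof.
have h := expR_half_le2 R; have e0 := expR_ge0 (2^-1 : R).
have : expR (2^-1 + 2^-1) = expR 1 :> R by congr expR; lra.
rewrite expRD; nra.
Qed.

(** The last two conclusions compare the denominators of the coherence bounds with c and c^2, where
    c^2 = M - sqrt (8 M L). The 12 is there to absorb both the 8 and the square being expanded. *)
Lemma gaussian_frame_numerics (R : realType) (M N : nat) (L := ln N%:R : R) :
  (0 < M)%N -> (0 < N)%N -> 60 * L <= M%:R -> M%:R <= (N%:R - 1) / (4 * L) ->
  [/\ (1 < N)%N, 2^-1 <= L, M%:R <= N%:R - 1 :> R,
     0 < Num.sqrt M%:R - Num.sqrt (12 * L) <= Num.sqrt (M%:R - Num.sqrt (8 * M%:R * L)) &
     0 < M%:R - Num.sqrt (12 * M%:R * L) <= M%:R - Num.sqrt (8 * M%:R * L)].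
Proof.
move=> M0' N0 h1 h2.
have N1 : 1 <= N%:R :> R by rewrite ler1n.
have M0 : 0 < M%:R :> R by rewrite ltr0n.
move: M%:R M0 h1 h2 => {M0'} m M0 h1 h2.
have L0 : 0 < L.
  rewrite lt_neqAle ln_ge0// andbT eq_sym; apply/eqP => L0.
  (* The case N = 1: division by 0 gives 0, so the upper bound on M would read M <= 0. *)
  by move: h2; rewrite L0 mulr0 invr0 mulr0; lra.
have hN : 4 * L * m <= N%:R - 1.
  by rewrite mulrC -ler_pdivlMr// mulr_gt0.
have N2 : (1 < N)%N by rewrite -(ltr1n R); have := mulr_gt0 L0 M0; lra.
have hL : 2^-1 <= L.
  rewrite -ler_expR lnK ?posrE; last by lra.
  by apply: le_trans (expR_half_le2 R) _; rewrite ler_nat.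
have MN : m <= N%:R - 1.
  apply: le_trans hN; rewrite -[leLHS]mul1r ler_wpM2r//; [exact: ltW|lra].
have e8 : 0 <= 8 * m * L by rewrite !mulr_ge0// ltW.
have e12 : 0 <= 12 * m * L by rewrite !mulr_ge0// ltW.
have s812 : Num.sqrt (8 * m * L) <= Num.sqrt (12 * m * L).
  by rewrite ler_wsqrtr// -!mulrA ler_wpM2r ?mulr_ge0 ?(ltW M0) ?(ltW L0)//; lra.
have sM : Num.sqrt (12 * m * L) < m.
  rewrite -ltr_sqr ?nnegrE ?sqrtr_ge0 ?(ltW M0)// sqr_sqrtr// expr2.
  by rewrite -mulrA mulrCA ltr_pM2l//; lra.
have s12 : 12 * L <= Num.sqrt (12 * m * L).
  rewrite -ler_sqr ?nnegrE ?sqrtr_ge0 ?mulr_ge0 ?(ltW L0)// sqr_sqrtr// expr2.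
  by rewrite mulrA ler_pM2r// -mulrA ler_pM2l//; lra.
have s0 : 0 < Num.sqrt m - Num.sqrt (12 * L).
  by rewrite subr_gt0 ltr_sqrt//; lra.
split=> //.
- apply/andP; split=> //.
  (* The square is M - 2 sqrt (12 M L) + 12 L. One of the two roots pays for 12 L, by 12 L <= M, and
     the other dominates sqrt (8 M L). *)
  rewrite -ler_sqr ?nnegrE ?sqrtr_ge0 ?(ltW s0)// sqr_sqrtr; last by lra.
  rewrite sqrrB !sqr_sqrtr ?(ltW M0)//; last by rewrite mulr_ge0// ltW.
  have -> : Num.sqrt m * Num.sqrt (12 * L) = Num.sqrt (12 * m * L).
    by rewrite -sqrtrM ?(ltW M0)//; congr Num.sqrt; ring.
  rewrite mulr2n; lra.
- by apply/andP; split; lra.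
Qed.

(** The budget, in units of 1 / N: 1 for the column norms (N events of probability N^-2), 2 for the
    pairs (N^2 events of probability 2 N^-3), 2 for the row sums (N events of probability 2 N^-2),
    and 4 >= e for the spectral norm. *)
Lemma gaussv_good_frame (R : realType) (M N : nat) (L := ln N%:R : R) :
  (0 < M)%N -> (0 < N)%N -> 60 * L <= M%:R -> M%:R <= (N%:R - 1) / (4 * L) ->
  ((1 - 9 * N%:R^-1)%:E <= gaussv R ('I_M * 'I_N)%type [set v |
    good_frame (Num.sqrt (15 * L) / (Num.sqrt M%:R - Num.sqrt (12 * L)))
      (Num.sqrt (15 * L) / (M%:R - Num.sqrt (12 * M%:R * L)))
      ((Num.sqrt M%:R + Num.sqrt N%:R + Num.sqrt (2 * L)) /
        Num.sqrt (M%:R - Num.sqrt (8 * M%:R * L))) (frame v)])%E.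
Proof.
move=> M0 N0 h1 h2.
have [N1 L2 MN /andP[d0 dc] /andP[b0 bc]] := gaussian_frame_numerics M0 N0 h1 h2.
rewrite -/L in L2 d0 dc b0 bc.
set c := Num.sqrt (M%:R - _) in dc *; set dd := _ - _ in d0 dc *.
set b := M%:R - Num.sqrt (12 * M%:R * L) in b0 bc *.
set l := Num.sqrt (2 * L); set s := _ + _ + l; set q := Num.sqrt (15 * L).
set c1 := q / dd; set c2 := q / b.
have L0 : 0 < L by lra.
have m0 : 0 < M%:R :> R by rewrite ltr0n.
have n0 : 0 < N%:R :> R by rewrite ltr0n.
have c0 : 0 < c by rewrite sqrtr_gt0; lra.
have n1 : 0 < N%:R - 1 :> R by rewrite subr_gt0 ltr1n.
have c2E : c ^+ 2 = M%:R - Num.sqrt (8 * M%:R * L) by rewrite sqr_sqrtr//; lra.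
have q0 : 0 <= q by exact: sqrtr_ge0.
have q2 : q ^+ 2 = 15 * L by rewrite sqr_sqrtr// mulr_ge0// ltW.
have c10 : 0 <= c1 by rewrite divr_ge0// ltW.
have c20 : 0 <= c2 by rewrite divr_ge0// ltW.
have l0 : 0 <= l by exact: sqrtr_ge0.
have l2 : l ^+ 2 = 2 * L by rewrite sqr_sqrtr// mulr_ge0// ltW.
have s0 : 0 <= s by rewrite !addr_ge0 ?sqrtr_ge0.
set x := N%:R^-1 : R; have x0 : 0 < x by rewrite invr_gt0.
have xE : expR (- L) = x by rewrite expRN lnK.
have xn : N%:R * x = 1 by rewrite mulfV// gt_eqF.
have xX k : expR (- (k%:R * L)) = x ^+ k by rewrite -mulrN mulrC expRM_natr xE.
pose E := gaussv R ('I_M * 'I_N)%type.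
pose S1 (j : 'I_N) := [set v : #|{: 'I_M * 'I_N}|.-tuple R | colnorm j v ^+ 2 < c ^+ 2].
pose tl t i r := [set v : #|{: 'I_M * 'I_N}|.-tuple R | t <= `|\sum_(j <- r) corr c i j v|].
pose S2 (p : 'I_N * 'I_N) := if p.1 != p.2 then tl c1 p.1 [:: p.2] else set0.
pose S3 (i : 'I_N) := tl ((N%:R - 1) * c2) i (enum (predC1 i)).
have mtl t i r : measurable (tl t i r) by exact: measurable_corr_tail.
have mS1 j : measurable (S1 j).
  rewrite -[X in measurable X]setTI; apply: (measurable_fun_ltr _ _) => //.
  by apply: measurable_funX; exact: measurable_colnorm.
have mS2 p : measurable (S2 p) by rewrite /S2; case: ifP.
have mS3 i : measurable (S3 i) by exact: mtl.
have PS1 j : (E (S1 j) <= (x ^+ 2)%:E)%E.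
  (* Solves M th^2 = 2 L; the threshold M - 2 M th of the tail bound is then exactly c^2. *)
  pose th := Num.sqrt (2 * L / M%:R).
  have th0 : 0 <= 2 * L / M%:R by rewrite divr_ge0 ?mulr_ge0// ltW.
  have := @gaussv_colnorm_tail R M N j th (sqrtr_ge0 _).
  rewrite sqr_sqrtr// (_ : M%:R * (2 * L / M%:R) = 2 * L); last by field; rewrite gt_eqF.
  rewrite xX (_ : 2 * M%:R * th = Num.sqrt (8 * M%:R * L)); first by rewrite -c2E.
  have mm : 0 <= 2 * M%:R :> R by rewrite mulr_ge0// ltW.
  rewrite -[2 * _](ger0_norm mm) -sqrtr_sqr -sqrtrM ?sqr_ge0//; congr Num.sqrt.
  by field; rewrite gt_eqF.
have PS2 p : (E (S2 p) <= (2 * x ^+ 3)%:E)%E.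
  rewrite /S2; case: ifP => [p12|_]; last first.
    by rewrite measure0 lee_fin mulr_ge0// exprn_ge0// ltW.
  have p12' : p.1 \notin [:: p.2] by rewrite inE.
  have h := @gaussv_corr_tail R M N c c1 p.1 [:: p.2] c0 c10 p12' isT isT.
  apply: (le_trans h).
  rewrite lee_fin ler_wpM2l// -xX ler_expR lerN2 mulr1.
  (* Since [dd <= c], the exponent is at least q^2 / 2 = 15 L / 2, more than the 3 L needed for a
     union over pairs. *)
  have : q ^+ 2 <= c1 ^+ 2 * c ^+ 2.
    have cc0 : 0 <= c1 * c := mulr_ge0 c10 (ltW c0).
    rewrite -exprMn ler_sqr// /c1 -mulrA ler_peMr//.
    by rewrite mulrC ler_pdivlMr// mul1r.
  by rewrite q2; lra.
have PS3 i : (E (S3 i) <= (2 * x ^+ 2)%:E)%E.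
  have sz : (size (enum (predC1 i)))%:R = N%:R - 1 :> R.
    by rewrite -cardE cardC1 card_ord -subn1 natrB.
  have t0 : 0 <= (N%:R - 1) * c2 by rewrite mulr_ge0// ltW.
  have ni : i \notin enum (predC1 i) by rewrite mem_enum inE eqxx.
  have r0 : (0 < size (enum (predC1 i)))%N by rewrite -(ltr0n R) sz.
  have h := @gaussv_corr_tail R M N c ((N%:R - 1) * c2) i (enum (predC1 i)) c0 t0 ni (enum_uniq _) r0.
  apply: (le_trans h); rewrite lee_fin ler_wpM2l// -xX ler_expR lerN2 sz exprMn.
  have -> : (N%:R - 1) ^+ 2 * c2 ^+ 2 * c ^+ 2 / (2 * (N%:R - 1)) =
      (N%:R - 1) * (c2 ^+ 2 * c ^+ 2) / 2 :> R by field; rewrite gt_eqF.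
  have bm : b <= M%:R by rewrite gerBl sqrtr_ge0.
  (* As b <= M <= N - 1 and b <= c^2, the right side is at least (b c2)^2 = q^2; half of it exceeds
     the 2 L needed here. This is where M <= N - 1 enters. *)
  have : q ^+ 2 <= (N%:R - 1) * (c2 ^+ 2 * c ^+ 2).
    apply: (@le_trans _ _ (b * (c2 ^+ 2 * b))).
      by rewrite /c2 le_eqVlt; apply/orP; left; apply/eqP; field; rewrite gt_eqF.
    have c22 : 0 <= c2 ^+ 2 by exact: sqr_ge0.
    apply: ler_pM; [exact: ltW|by rewrite mulr_ge0// ltW|exact: le_trans bm MN|].
    by rewrite ler_wpM2l// c2E.
  by rewrite q2; lra.
(* Squared, this is 50 L <= M, which follows from 60 L <= M. *)
have lM : 5 * l <= Num.sqrt M%:R.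
  rewrite -ler_sqr ?nnegrE ?mulr_ge0 ?sqrtr_ge0// exprMn l2 sqr_sqrtr ?(ltW m0)//; lra.
have lN : 5 * l <= Num.sqrt N%:R.
  by apply: le_trans lM _; rewrite ler_wsqrtr//; lra.
have [D [mD PD DP]] := gaussian_opnorm_tail M0 N0 l0 lM lN.
have {}PD : (E D <= (4 * x)%:E)%E.
  apply: (le_trans PD); rewrite lee_fin l2 expRD -xE (_ : - (2 * L / 2) = - L); last by lra.
  by apply: ler_wpM2r; [exact: expR_ge0|exact: expR1_le4].
set good := mkset _.
have mgood : measurable good.
  by apply: measurable_good_frame => //; rewrite divr_ge0// ltW.
pose B1 := \bigcup_(j in [set: 'I_N]) S1 j.
pose B2 := \bigcup_(p in [set: 'I_N * 'I_N]) S2 p.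
pose B3 := \bigcup_(i in [set: 'I_N]) S3 i.
have mB1 : measurable B1 by exact: fin_bigcup_measurable.
have mB2 : measurable B2 by exact: fin_bigcup_measurable.
have mB3 : measurable B3 by exact: fin_bigcup_measurable.
have bad : ~` good `<=` B1 `|` (B2 `|` (B3 `|` D)).
  move=> v; apply: contra_notP => /not_orP[nB1 /not_orP[nB2 /not_orP[nB3 nD]]].
  apply: good_frame_of_corr => //.
  - by move=> j; rewrite leNgt; apply/negP => h; apply: nB1; exists j.
  - move=> i j ij; rewrite leNgt; apply/negP => /ltW h; apply: nB2; exists (i, j) => //.
    by rewrite /S2 /= ij /tl /= big_seq1.
  - move=> i; rewrite leNgt; apply/negP => /ltW h; apply: nB3; exists i => //.
    by rewrite /S3 /tl /= big_enum.
  - exact: DP.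
have Pbad : (E (~` good) <= (9 * x)%:E)%E.
  have mbad := measurableU _ _ mB1 (measurableU _ _ mB2 (measurableU _ _ mB3 mD)).
  apply: (le_trans (le_measure E (mem_set (measurableC mgood)) (mem_set mbad) bad)).
  apply: (le_trans (measureU2 _ mB1 (measurableU _ _ mB2 (measurableU _ _ mB3 mD)))).
  apply: (le_trans (leeD (lexx _) (measureU2 _ mB2 (measurableU _ _ mB3 mD)))).
  apply: (le_trans (leeD (lexx _) (leeD (lexx _) (measureU2 _ mB3 mD)))).
  have := leeD (measure_bigcup_le mS1 PS1) (leeD (measure_bigcup_le mS2 PS2)
    (leeD (measure_bigcup_le mS3 PS3) PD)).
  move=> h; apply: (le_trans h); rewrite -!EFinD lee_fin card_prod card_ord natrM.
  have -> : N%:R * x ^+ 2 = x by rewrite expr2 mulrA xn mul1r.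
  have -> : N%:R * N%:R * (2 * x ^+ 3) = 2 * x * (N%:R * x) ^+ 2 by ring.
  have -> : N%:R * (2 * x ^+ 2) = 2 * x * (N%:R * x) by ring.
  by rewrite xn; lra.
have := probability_setC E (measurableC mgood); rewrite setCK => ->.
by rewrite EFinB leeB.
Qed.

Theorem theorem2 (R : realType) (d : measure_display) (T : measurableType d)
    (P : probability T R) (M N : nat) (hM : (0 < M)%N) (hN : (0 < N)%N)
    (hlow : 60 * ln N%:R <= M%:R :> R)
    (hup : M%:R <= (N%:R - 1) / (4 * ln N%:R) :> R)
    (G : 'I_M -> 'I_N -> {RV P >-> R}) (hG : iid_gaussian_matrix G) :
  ((1 - 11 * N%:R^-1)%:E <
   P [set w | let F := normalized_gaussian_frame G w in
        [/\ worst_case_coherence F <=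
              Num.sqrt (15 * ln N%:R) /
              (Num.sqrt M%:R - Num.sqrt (12 * ln N%:R)),
            average_coherence F <=
              Num.sqrt (15 * ln N%:R) /
              (M%:R - Num.sqrt (12 * M%:R * ln N%:R)) &
            spectral_norm F <=
              (Num.sqrt M%:R + Num.sqrt N%:R + Num.sqrt (2 * ln N%:R)) /
              Num.sqrt (M%:R - Num.sqrt (8 * M%:R * ln N%:R))]%R])%E.
Proof.
have c30 : 0 <= (Num.sqrt M%:R + Num.sqrt N%:R + Num.sqrt (2 * ln N%:R)) /
    Num.sqrt (M%:R - Num.sqrt (8 * M%:R * ln N%:R)) :> R.
  by rewrite divr_ge0 ?addr_ge0 ?sqrtr_ge0.
have h := gaussv_good_frame hM hN hlow hup.
rewrite -(probability_gaussian_frame hG (measurable_good_frame _ _ hN c30)) in h.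
(* The failure probability found is at most 9 / N, so the inequality with 11 is strict. *)
apply: lt_le_trans h.
by rewrite lte_fin ltrD2l ltrN2 ltr_pM2r ?invr_gt0 ?ltr0n// ltr_nat.
Qed.
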